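(* Let $\{\mu_\ell\}_{\ell\ge0}$ be the eigenvalues of $T_K$, where $\mu_\ell$ is the eigenvalue on $\mathcal H_\ell$. Let $\bar k_0$ be a fixed nonnegative integer. Then there are constants $d_0,c,C>0$ (depending on $\bar k_0$) such that for all $d\ge d_0$ and $0\le k\le\bar k_0$, $c\,d^{-k}\le\mu_k\le C\,d^{-k}$. Moreover, for all $x,x'\in S^{d-1}$, $$K(x,x')=\sum_{\ell\ge0}\mu_\ell\sum_{j=1}^{N(d,\ell)}Y_{\ell j}(x)Y_{\ell j}(x')=\sum_{\ell\ge0}\mu_\ell N(d,\ell)P_\ell(\langle x,x'\rangle),$$ with $T_KY_{\ell j}=\mu_\ell Y_{\ell j}$ for all $\ell,j$, and the series converges absolutely and uniformly on $S^{d-1}\times S^{d-1}$.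
   Context: $K=K^{(0)}+K^{(1)}$ on $S^{d-1}\times S^{d-1}$ with $K^{(0)}(u,v)=\frac{\pi-\arccos(u^\top v)}{2\pi}$ and $K^{(1)}(u,v)=u^\top v\,K^{(0)}(u,v)$. $\mu$ is the uniform probability measure on $S^{d-1}$ and $T_Kf(x)=\int K(x,x')f(x')\,d\mu(x')$. $\mathcal H_\ell$ is the space of degree-$\ell$ spherical harmonics (restrictions to $S^{d-1}$ of homogeneous harmonic polynomials of degree $\ell$), of dimension $N(d,\ell)=\frac{2\ell+d-2}{\ell}\binom{\ell+d-3}{d-2}$, with $L^2(\mu)$-orthonormal basis $\{Y_{\ell j}\}_{j=1}^{N(d,\ell)}$. $P_\ell$ is the degree-$\ell$ Legendre (Gegenbauer) polynomial in dimension $d$, normalized so that $\sum_{j}Y_{\ell j}(x)Y_{\ell j}(x')=N(d,\ell)P_\ell(\langle x,x'\rangle)$. *)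

(* Defs.v *)
From HB Require Import structures.
From mathcomp Require Import all_boot all_order all_algebra.
From mathcomp Require Import all_classical all_reals all_analysis.
From mathcomp Require mpoly.

Set Implicit Arguments.
Unset Strict Implicit.
Unset Printing Implicit Defensive.

Import Order.TTheory GRing.Theory Num.Theory.
Local Open Scope classical_set_scope.
Local Open Scope ring_scope.

Section NTKDefs.
Variable R : realType.

(* Points of R^d are d-tuples (this type carries the product = Borel
   sigma-algebra of mathcomp-analysis). *)
Definition dotp (d : nat) (x y : d.-tuple R) : R :=
  \sum_(i < d) tnth x i * tnth y i.

Definition sphere (d : nat) : set (d.-tuple R) := [set x | dotp x x = 1].
Arguments sphere : clear implicits.

(* mu is the uniform (normalized surface / Haar) probability measure on
   S^{d-1}: a probability measure on R^d concentrated on S^{d-1} and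
   invariant under every orthogonal transformation (= map preserving the
   inner product).  This characterizes it uniquely. *)
Definition uniform_sphere_measure (d : nat)
    (P : probability (d.-tuple R) R) : Prop :=
  P (~` sphere d) = 0%E /\
  forall f : d.-tuple R -> d.-tuple R,
    (forall x y, dotp (f x) (f y) = dotp x y) ->
    forall A, measurable A -> P (f @^-1` A) = P A.

Definition K0 (d : nat) (u v : d.-tuple R) : R :=
  (pi - acos (dotp u v)) / (2 * pi).
Definition K1 (d : nat) (u v : d.-tuple R) : R := dotp u v * K0 u v.
Definition Kker (d : nat) (u v : d.-tuple R) : R := K0 u v + K1 u v.

Definition TK (d : nat) (P : probability (d.-tuple R) R)
    (f : d.-tuple R -> R) (x : d.-tuple R) : R :=
  Rintegral P setT (fun x' => Kker x x' * f x').

Definition homog_harmonic (d l : nat) (p : mpoly.mpoly d R) : Prop :=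
  all (fun m => mpoly.mdeg m == l) (mpoly.msupp p) /\
  \sum_(i < d) mpoly.mderiv i (mpoly.mderiv i p) = 0.

Definition sph_harm (d l : nat) (Y : d.-tuple R -> R) : Prop :=
  exists p : mpoly.mpoly d R, homog_harmonic l p /\
    forall x, sphere d x -> Y x = mpoly.meval (tnth x) p.

Definition is_eig_on_H (d : nat) (P : probability (d.-tuple R) R)
    (l : nat) (m : R) : Prop :=
  forall Y, sph_harm l Y -> forall x, sphere d x -> TK P Y x = m * Y x.

Definition mu_eig (d : nat) (P : probability (d.-tuple R) R) (l : nat) : R :=
  xget 0 [set m | is_eig_on_H P l m].

(* Legendre (Gegenbauer) polynomial of degree l in dimension d, normalized
   by P_l(1) = 1, via the three-term recurrence
   (l+d-2) P_{l+1}(t) = (2l+d-2) t P_l(t) - l P_{l-1}(t). *)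
Fixpoint legendre_pair (d l : nat) (t : R) : R * R :=
  match l with
  | 0 => (1, t)
  | l'.+1 =>
      let pr := legendre_pair d l' t in
      (pr.2, (((2 * l'.+1 + d - 2)%N%:R * t * pr.2 - l'.+1%:R * pr.1)
               / (l'.+1 + d - 2)%N%:R))
  end.
Definition legendreP (d l : nat) (t : R) : R := (legendre_pair d l t).1.

End NTKDefs.
Arguments sphere {R} d.

(* N(d,l) = (2l+d-2)/l * binom(l+d-3, d-2), with N(d,0) = 1
   (the division is exact). *)
Definition Ndim (d l : nat) : nat :=
  (if l == 0 then 1 else ((2 * l + d - 2) * 'C(l + d - 3, d - 2)) %/ l)%N.

(* Main.v *)
(** Rotation invariance is used only infinitesimally: the mean E p of a
    polynomial p over the sphere kills X_i d_j p - X_j d_i p.  Summing over i, j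
    yields the divergence theorem and Green's formula for homogeneous
    polynomials, hence for a harmonic q of degree l and a unit vector x
      (n - l) (n + l + d - 2) E(<x,.>^n q) = n (n - 1) E(<x,.>^(n-2) q)
    and E(<x,.>^l q) = l! / (d (d+2) ... (d+2l-2)) q(x).  So <x,.>^n acts on H_l
    as a scalar lam(n,l) >= 0 which vanishes for n < l.

    The kernel is a power series sum_n a_n t^n with a_n > 0 and sum_n a_n = 1,
    whence mu_l = sum_n a_n lam(n,l).  For d >= l^2 + 2 the recurrence gives
    lam(n,l) <= lam(l,l), so mu_l lies between a_l lam(l,l) and lam(l,l), both of
    order d^-l.

    Expanding t^n = sum_l N(d,l) lam(n,l) P_l(t), a convex combination because
    P_l(1) = 1, and using |P_l| <= 1, bounds the tail of sum_l mu_l N(d,l) P_l(t)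
    from l = m on by sum_(n >= m) a_n, uniformly in t. *)

Require Import Defs.
From HB Require Import structures.
From mathcomp Require Import all_boot all_order all_algebra.
From mathcomp Require Import all_classical all_reals all_analysis.
From mathcomp Require Import measurable_realfun.
From mathcomp Require Import ring lra zify.
From mathcomp Require Import -(notations) mpoly.
Set Implicit Arguments.
Unset Strict Implicit.
Unset Printing Implicit Defensive.

Import Order.TTheory GRing.Theory Num.Theory.
Import numFieldNormedType.Exports.
Local Open Scope classical_set_scope.
Local Open Scope ring_scope.

(** * Power series of the kernel *)

(** The diagonal x = x' is the endpoint t = 1, where arcsin has unbounded derivative, so uniform
    convergence up to it needs more than an estimate inside ]-1, 1[. Substituting t = sin s settles
    this: the derivative in s of the partial sums telescopes and stays below 1, so the error grows
    on [0, pi/2] and is worst at t = 1. As all coefficients are positive, this one endpoint error,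
    [kernel_tail], then dominates every other one: of the kernel, of T_K on H_l, of the eigenvalues
    and of the Legendre series. Infinite sums are mostly avoided: identities are proved up to
    [kernel_tail n * B] for a fixed B and concluded by [le_of_kernel_tail].

    Harmonics are handled as polynomials, not as functions on the sphere. Homogeneity is Euler's
    identity, and P_l is lifted to a homogeneous polynomial [zonal], so that harmonicity,
    orthogonality and the reproducing property all become consequences of the recurrence and of two
    integral formulas. *)

Section ArcsineSeries.
Context {R : realType}.
Implicit Types (t e : R) (n N : nat).

(* Coefficients of (1 - s^2)^(-1/2): [beta n] = binom(2n, n) / 4^n. *)
Fixpoint beta n : R :=
  if n is n'.+1 then beta n' * ((2 * n' + 1)%:R / (2 * n' + 2)%:R) else 1.

Definition asin_coef n : R := beta n / (2 * n + 1)%:R.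

Definition asin_psum N t := \sum_(n < N) asin_coef n * t ^+ (2 * n + 1).

(* Derivative of [asin_psum N \o sin]; it increases to 1 on [0, pi/2[. *)
Definition asin_dpsum N t :=
  \sum_(n < N) beta n * (cos t * sin t ^+ (2 * n)).

Lemma beta_gt0 n : 0 < beta n.
Proof.
by elim: n => //= n IH; rewrite mulr_gt0 // divr_gt0 // ltr0n ?addn1 ?addn2.
Qed.

Lemma beta_le1 n : beta n <= 1.
Proof.
elim: n => //= n IH; apply: mulr_ile1; rewrite ?(ltW (beta_gt0 _)) ?divr_ge0 //.
by rewrite ler_pdivrMr ?mul1r ?ler_nat ?ltr0n ?addn2 ?addn1.
Qed.

Lemma asin_coef_gt0 n : 0 < asin_coef n.
Proof. by rewrite divr_gt0 ?beta_gt0 // ltr0n addn1. Qed.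

Lemma is_derive_sinXn k t :
  is_derive t 1 (fun s : R => sin s ^+ k) (k%:R * sin t ^+ k.-1 * cos t).
Proof.
rewrite (_ : (fun s => _) = (@sin R) ^+ k); last first.
  by apply/funext => s; rewrite !fctE.
by apply: is_derive_eq; rewrite /GRing.scale /=.
Qed.

Lemma is_derive_asin_psum N t :
  is_derive t 1 (fun s : R => asin_psum N (sin s)) (asin_dpsum N t).
Proof.
elim: N => [|N IH].
  rewrite (_ : (fun s => _) = cst 0); last first.
    by apply/funext => s; rewrite /asin_psum big_ord0.
  by rewrite /asin_dpsum big_ord0; exact: is_derive_cst.
rewrite (_ : (fun s => _) = (fun s : R => asin_psum N (sin s)) +
    (asin_coef N \*: (fun s : R => sin s ^+ (2 * N + 1)))); last first.
  by apply/funext => s; rewrite /asin_psum big_ord_recr.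
have H := is_derive_sinXn (2 * N + 1) t.
apply: is_derive_eq; rewrite /asin_dpsum big_ord_recr /=; congr (_ + _).
rewrite /GRing.scale /= /asin_coef addn1 /=; field.
by rewrite addrC -natrM natr1 pnatr_eq0.
Qed.

(** The sum telescopes: by cos^2 = 1 - sin^2 the n-th term has derivative beta_n (2n sin^(2n-1) -
    (2n+1) sin^(2n+1)), and (2n+1) beta_n = (2n+2) beta_(n+1) is exactly the recursion of [beta]. *)
Lemma is_derive_asin_dpsum N t :
  is_derive t 1 (fun s : R => asin_dpsum N s)
    (- ((2 * N)%:R * beta N * sin t ^+ (2 * N).-1)).
Proof.
elim: N => [|N IH].
  rewrite (_ : (fun s => _) = cst 0); last first.
    by apply/funext => s; rewrite /asin_dpsum big_ord0.
  by rewrite muln0 !mul0r oppr0; exact: is_derive_cst.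
rewrite (_ : (fun s => _) = (fun s : R => asin_dpsum N s) +
    (beta N \*: ((@cos R) * (fun s : R => sin s ^+ (2 * N))))); last first.
  by apply/funext => s; rewrite /asin_dpsum big_ord_recr.
have H := is_derive_sinXn (2 * N) t.
rewrite (_ : (2 * N.+1).-1 = (2 * N).+1); last by lia.
apply: is_derive_eq; rewrite /GRing.scale /= ?fctE.
have c2 : cos t * cos t = 1 - sin t * sin t.
  by have := cos2Dsin2 t; rewrite !expr2 => <-; ring.
have nz : 2 * N%:R + 2 != 0 :> R by rewrite -natrM -natrD pnatr_eq0 addn2.
rewrite exprS (_ : (2 * N.+1)%:R = 2 * N%:R + 2); last by ring.
rewrite (natrD _ _ 1) (natrD _ _ 2) natrM.
have -> : (2 * N%:R + 2) * (beta N * ((2 * N%:R + 1) / (2 * N%:R + 2)))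
    = beta N * (2 * N%:R + 1) :> R by field.
set s := sin t; set u := s ^+ (2 * N).-1; set v := s ^+ (2 * N).
(* The factor N covers N = 0, where the truncated exponent [(2 * N).-1] makes v = s * u fail. *)
have vE : N%:R * v = N%:R * (s * u).
  by rewrite /u /v; case: (N) => [|k]; rewrite ?mul0r // -exprS prednK ?muln_gt0.
have -> : cos t * (2 * N%:R * u * cos t) = 2 * N%:R * u * (1 - s * s).
  by rewrite -c2; ring.
transitivity (- (beta N * (2 * (N%:R * v) * s + v * s))); last by ring.
rewrite vE; ring.
Qed.

Lemma mean_value_bound (f df : R -> R) (a b M : R) : a <= b ->
  (forall x : R, is_derive x 1 f (df x)) ->
  (forall x, a <= x <= b -> df x <= M) -> f b - f a <= M * (b - a).
Proof.
move=> ab fdf dfM.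
have cf : {within `[a, b], continuous f}.
  by apply: derivable_within_continuous => x _; exact: ex_derive.
have [c] := MVT_segment ab (fun x _ => fdf x) cf.
rewrite in_itv /= => cab ->.
by rewrite ler_wpM2r ?subr_ge0 // dfM.
Qed.

Lemma sin_range t : 0 <= t <= pi / 2 -> 0 <= sin t.
Proof.
move=> /andP[t0 tpi]; apply: sin_ge0_pi; rewrite t0 (le_trans tpi) //.
by have := pi_ge0 R; lra.
Qed.

Lemma asin_dpsum0 N : asin_dpsum N.+1 0 = 1.
Proof.
rewrite /asin_dpsum big_ord_recl big1 => [|i _].
  by rewrite /= cos0 muln0 expr0 !mul1r addr0.
by rewrite sin0 lift0 mulnS expr0n /= !mulr0.
Qed.

Lemma asin_dpsum_le1 N t : 0 <= t <= pi / 2 -> asin_dpsum N.+1 t <= 1.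
Proof.
move=> /andP[t0 tpi].
have := mean_value_bound t0 (is_derive_asin_dpsum N.+1).
move=> /(_ 0); rewrite asin_dpsum0 mul0r => h.
rewrite -subr_le0 h // => x /andP[x0 xt].
have sx0 : 0 <= sin x by apply: sin_range; rewrite x0 (le_trans xt).
by rewrite oppr_le0 !mulr_ge0 ?exprn_ge0 ?(ltW (beta_gt0 _)).
Qed.

(** The single term left by the telescoping is bounded through sin x <= sin t0 and [beta_le1]. For
    t0 < pi/2 the right-hand side tends to 0 with N. *)
Lemma asin_dpsum_ge N t0 t : 0 <= t0 <= pi / 2 -> 0 <= t <= t0 ->
  1 - asin_dpsum N.+1 t <= (2 * N.+1)%:R * sin t0 ^+ (2 * N).+1 * t0.
Proof.
move=> /andP[t00 t0p] /andP[t_ge0 tt0].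
have sl x : 0 <= x <= t -> sin x <= sin t0.
  move=> /andP[x0 xt]; have [->//|] := eqVneq x t0.
  rewrite neq_lt => /orP[xt0|]; last by rewrite ltNge (le_trans xt tt0).
  by rewrite ltW // ltr_sin // in_itv /=; have := pi_ge0 R; lra.
have dN (x : R) : is_derive x 1 (- (fun s => asin_dpsum N.+1 s))
    ((2 * N.+1)%:R * beta N.+1 * sin x ^+ (2 * N.+1).-1).
  have H := is_derive_asin_dpsum N.+1 x.
  by apply: is_derive_eq; rewrite opprK.
have := mean_value_bound t_ge0 dN.
move=> /(_ ((2 * N.+1)%:R * sin t0 ^+ (2 * N).+1)).
rewrite !fctE asin_dpsum0 opprK subr0 addrC => h.
apply: (le_trans (h _)); last first.
  by rewrite ler_wpM2l // mulr_ge0 // exprn_ge0 // sin_range // t00.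
move=> x xt; rewrite (_ : (2 * N.+1).-1 = (2 * N).+1); last by lia.
have sx0 : 0 <= sin x by apply: sin_range; move: xt; lra.
rewrite ler_pM ?exprn_ge0 // ?mulr_ge0 ?(ltW (beta_gt0 _)) //.
  by rewrite ler_piMr ?beta_le1.
by rewrite lerXn2r ?nnegrE ?sl // (le_trans sx0) // sl.
Qed.

(** The error has derivative 1 - [asin_dpsum], which is nonnegative on [0, pi/2]. *)
Lemma asin_psum_gap_mono N s t : 0 <= s -> s <= t -> t <= pi / 2 ->
  s - asin_psum N.+1 (sin s) <= t - asin_psum N.+1 (sin t).
Proof.
move=> s0 st tp.
have := mean_value_bound st (is_derive_asin_psum N.+1).
move=> /(_ 1) h; have {h} : asin_psum N.+1 (sin t) - asin_psum N.+1 (sin s) <= 1 * (t - s).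
  by apply: h => x /andP[sx xt]; apply: asin_dpsum_le1; rewrite (le_trans s0) //= (le_trans xt).
lra.
Qed.

Lemma asin_psum0 N : asin_psum N 0 = 0.
Proof. by rewrite /asin_psum big1 // => i _; rewrite addn1 expr0n mulr0. Qed.

Lemma asin_psumN N t : asin_psum N (- t) = - asin_psum N t.
Proof.
rewrite /asin_psum -sumrN; apply: eq_bigr => i _.
by rewrite exprNn addn1 exprS exprM sqrrN !expr1n; ring.
Qed.

Definition asin_gap N : R := pi / 2 - asin_psum N 1.

Lemma asin_gap_ge0 N : 0 <= asin_gap N.+1.
Proof.
have p0 : 0 <= pi / 2 :> R by have := pi_ge0 R; lra.
have := asin_psum_gap_mono N (lexx 0) p0 (lexx _).
by rewrite sin0 sin_pihalf asin_psum0 subr0.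
Qed.

(** By oddness t >= 0 suffices; there the error increases from 0 at t = 0 to [asin_gap] at pi/2. *)
Lemma asin_psum_bound N t : - (pi / 2) <= t <= pi / 2 ->
  `|t - asin_psum N.+1 (sin t)| <= asin_gap N.+1.
Proof.
wlog t0 : t / 0 <= t => [h|] tp.
  have [/h ->//|t0] := leP 0 t.
  rewrite -normrN opprB addrC -{1}[asin_psum _ _]opprK -asin_psumN -sinN.
  by rewrite h //; move: tp t0; lra.
rewrite ger0_norm.
  have tp' : t <= pi / 2 by move: tp; lra.
  by have := asin_psum_gap_mono N t0 tp' (lexx _); rewrite sin_pihalf.
have := asin_psum_gap_mono N (lexx 0) t0; rewrite sin0 asin_psum0 subr0; apply.
by move: tp; lra.
Qed.

Lemma bernoulli (h : R) n : 0 <= h -> 1 + n%:R * h <= (1 + h) ^+ n.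
Proof.
move=> h0; elim: n => [|n IH]; first by rewrite mul0r addr0 expr0.
rewrite exprS; apply: (@le_trans _ _ ((1 + h) * (1 + n%:R * h))).
  have : 0 <= n%:R * h * h by rewrite !mulr_ge0.
  by rewrite -natr1; nra.
by rewrite ler_wpM2l // addr_ge0.
Qed.

(** With x = 1 / (1 + h), Bernoulli gives x^n n h <= 1. Squaring yields n x^(2n) <= 1 / (n h^2),
    which beats the factor n. *)
Lemma natmul_expr_small (x e : R) : 0 <= x < 1 -> 0 < e ->
  exists n0, forall n, (n0 <= n)%N -> n%:R * x ^+ (2 * n) <= e.
Proof.
move=> /andP[x0 x1] e0.
have [->|xn0] := eqVneq x 0.
  exists 0%N => n _; case: n => [|n]; first by rewrite mul0r ltW.
  by rewrite expr0n mulnS /= mulr0 ltW.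
have {x0} x0 : 0 < x by rewrite lt_neqAle eq_sym xn0.
pose h := x^-1 - 1.
have h0 : 0 < h by rewrite subr_gt0 invf_gt1.
have he : 0 < h ^+ 2 * e by rewrite mulr_gt0 // exprn_gt0.
have [m mh] : exists m : nat, (h ^+ 2 * e)^-1 < m%:R.
  exists (Num.bound (h ^+ 2 * e)^-1).
  by rewrite archi_boundP // invr_ge0 ltW.
exists m.+1 => n mn.
have nm : (h ^+ 2 * e)^-1 < n%:R by rewrite (lt_le_trans mh) // ler_nat ltnW.
have n0 : 0 < n%:R :> R by rewrite ltr0n; lia.
have xn : x ^+ n * (n%:R * h) <= 1.
  have -> : x = (1 + h)^-1 by rewrite /h addrC subrK invrK.
  rewrite exprVn mulrC ler_pdivrMr ?mul1r ?exprn_gt0 ?(addr_gt0 ltr01 h0) //.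
  by rewrite (le_trans _ (bernoulli n (ltW h0))) // ler_wpDl.
have xn0' : 0 <= x ^+ n * (n%:R * h) by rewrite !mulr_ge0 ?exprn_ge0 // ltW.
have : (x ^+ n * (n%:R * h)) ^+ 2 <= 1 by rewrite exprn_ile1.
rewrite mulnC exprM !exprMn => hh.
have nn : 1 <= n%:R * (h ^+ 2 * e) by rewrite -ler_pdivrMr // div1r ltW.
set y := (x ^+ n) ^+ 2 in hh *; have y0 : 0 <= y by rewrite exprn_ge0 // exprn_ge0 // ltW.
rewrite -(@ler_pM2l _ (n%:R * h ^+ 2)) ?mulr_gt0 ?exprn_gt0 //.
apply: (@le_trans _ _ 1); last by rewrite -mulrA.
by apply: le_trans hh; rewrite le_eqVlt; apply/orP; left; apply/eqP; ring.
Qed.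

(** Take t0 slightly below pi/2. Positive coefficients make the partial sum at 1 at least the one at
    sin t0, so the gap is at most pi/2 - t0 plus the error at t0, and that error vanishes in the
    limit by [asin_dpsum_ge]. *)
Lemma asin_gap_cvg0 e : 0 < e ->
  exists N0, forall N, (N0 <= N)%N -> asin_gap N.+1 <= e.
Proof.
move=> e0.
have p2 := pihalf_ge1 R.
pose de := Num.min (e / 2) 1.
have de0 : 0 < de by rewrite lt_min ltr01 andbT divr_gt0.
have [de1 de2] : de <= e / 2 /\ de <= 1 by split; rewrite ge_min lexx ?orbT.
pose t0 := pi / 2 - de.
have t00 : 0 <= t0 by rewrite /t0; lra.
have t0p : t0 < pi / 2 by rewrite /t0; lra.
have s0 : 0 <= sin t0 by apply: sin_range; rewrite t00 ltW.
have s1 : sin t0 < 1 by rewrite -sin_pihalf ltr_sin // in_itv /=; lra.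
(* For N >= 1, 2N + 2 <= 4N costs a factor 4, and t0 * t0 <= 4 another one: 32 leaves e / 2, the
   other half being pi/2 - t0. *)
have [N0 hN0] : exists n0, forall n, (n0 <= n)%N -> n%:R * sin t0 ^+ (2 * n) <= e / 32.
  by apply: natmul_expr_small; rewrite ?s0 // divr_gt0.
exists N0.+1 => N NN.
have t0r : 0 <= t0 <= pi / 2 by rewrite t00 ltW.
have psum_mono : asin_psum N.+1 (sin t0) <= asin_psum N.+1 1.
  apply: ler_sum => i _; rewrite ler_wpM2l ?(ltW (asin_coef_gt0 _)) //.
  by rewrite expr1n exprn_ile1 // ltW.
have hN := hN0 N (ltnW NN).
pose M := (2 * N.+1)%:R * sin t0 ^+ (2 * N).+1 * t0.
have hM : t0 - asin_psum N.+1 (sin t0) <= M * (t0 - 0).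
  have dd (x : R) : is_derive x 1 ((fun s => s) - (fun s => asin_psum N.+1 (sin s)))
      (1 - asin_dpsum N.+1 x).
    have H := is_derive_asin_psum N.+1 x.
    by apply: is_derive_eq.
  have := mean_value_bound t00 dd; move=> /(_ M).
  rewrite !fctE sin0 asin_psum0 subr0 subr0; apply => x xt.
  exact: asin_dpsum_ge.
have t02 : t0 <= 2 by rewrite /t0; have := pihalf_lt2 R; lra.
have : M * t0 <= e / 2.
  have N2 : (2 * N.+1)%:R <= 4 * N%:R :> R by rewrite -natrM ler_nat; lia.
  have M1 : M <= 4 * (e / 32) * t0.
    rewrite ler_wpM2r // (le_trans (ler_wpM2r _ N2)) ?exprn_ge0 //.
    rewrite -mulrA ler_wpM2l // (le_trans _ hN) // ler_wpM2l //.
    by rewrite exprS ler_piMl ?exprn_ge0 // ltW.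
  have := ler_wpM2r t00 M1; move/le_trans; apply.
  have tt : t0 * t0 <= 2 * 2 by rewrite ler_pM.
  have e8 : 0 <= e / 8 by rewrite divr_ge0 // ltW.
  have := ler_wpM2l e8 tt.
  rewrite (_ : 4 * (e / 32) * t0 * t0 = e / 8 * (t0 * t0)); last by field.
  lra.
rewrite /asin_gap; move: hM psum_mono; rewrite subr0 {1}/t0; lra.
Qed.

End ArcsineSeries.

(** * Expansion of the kernel in powers of t = <x, x'> *)

Section KernelSeries.
Context {R : realType}.

Definition kernel (t : R) : R := (1 + t) * ((pi - acos t) / (2 * pi)).

(** Since pi - arccos t = pi/2 + arcsin t, the kernel is (1 + t) (1/4 + arcsin t / (2 pi)). The
    factor 1 + t copies the arcsine coefficient of degree 2k + 1 to degree 2k + 2, hence the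
    halving. *)
Definition kernel_coef (n : nat) : R :=
  (if (n < 2)%N then 1 / 4 else 0) +
  (if n is n'.+1 then asin_coef n'./2 / (2 * pi) else 0).

(** The coefficients sum to [kernel 1] = 1, so this is their sum from n on, written with a finite
    sum. *)
Definition kernel_tail (n : nat) : R := 1 - \sum_(i < n) kernel_coef i.

Lemma kernel_coef_gt0 n : 0 < kernel_coef n.
Proof.
rewrite /kernel_coef; case: n => [|n] /=; first by rewrite addr0 divr_gt0.
apply: ltr_wpDl; first by case: ifP => // _; rewrite divr_ge0.
by rewrite divr_gt0 ?asin_coef_gt0 // mulr_gt0 // pi_gt0.
Qed.

(** The product of 1 + t with a polynomial of degree 2N + 1 fills the degrees 0 to 2N + 2, whence
    the length 2N + 3. *)
Lemma kernel_psum N (t : R) : \sum_(i < 2 * N + 3) kernel_coef i * t ^+ i =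
  (1 + t) * (1 / 4 + asin_psum N.+1 t / (2 * pi)).
Proof.
have p0 : pi != 0 :> R by rewrite gt_eqF // pi_gt0.
elim: N => [|N IH].
  rewrite muln0 /= !big_ord_recl big_ord0 /kernel_coef /= /asin_psum big_ord1 /=.
  by rewrite expr0 expr1 !add0r; move: (@pi R) p0 => p p0; field.
have -> : (2 * N.+1 + 3 = (2 * N + 3).+2)%N by lia.
have k1 : kernel_coef (2 * N + 3) = asin_coef N.+1 / (2 * pi).
  rewrite /kernel_coef addn3 (_ : (2 * N).+2./2 = N.+1) ?add0r //; lia.
have k2 : kernel_coef (2 * N + 3).+1 = asin_coef N.+1 / (2 * pi).
  rewrite /kernel_coef addn3 (_ : (2 * N).+3./2 = N.+1) ?add0r //; lia.
rewrite !big_ord_recr /= IH [in RHS]/asin_psum big_ord_recr /= -/(asin_psum _ _).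
rewrite k1 k2 (_ : (2 * N.+1 + 1 = 2 * N + 3)%N); last by lia.
by rewrite exprS; move: (@pi R) p0 => p p0; field.
Qed.

Lemma kernel_tail_odd N : kernel_tail (2 * N + 3) = asin_gap N.+1 / pi.
Proof.
have p0 : pi != 0 :> R by rewrite gt_eqF // pi_gt0.
have := kernel_psum N 1; rewrite /kernel_tail.
under eq_bigr do rewrite expr1n mulr1.
by move=> ->; rewrite /asin_gap; move: (@pi R) p0 => p p0; field.
Qed.

(** This amounts to nonnegative tails. At lengths 2k + 3 the tail is [asin_gap] over pi; positive
    coefficients carry the sign down to every k. *)
Lemma kernel_coef_sum_le m n : \sum_(m <= i < n) kernel_coef i <= kernel_tail m.
Proof.
have tail_ge0 k : 0 <= kernel_tail k.
  have := divr_ge0 (asin_gap_ge0 k) (pi_ge0 R).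
  rewrite -kernel_tail_odd /kernel_tail.
  rewrite (_ : (2 * k + 3 = k + (k + 3))%N); last by lia.
  rewrite big_split_ord /= opprD addrA => h; rewrite (le_trans h) // gerBl.
  by apply: sumr_ge0 => i _; rewrite ltW // kernel_coef_gt0.
have [mn|nm] := leqP m n; last by rewrite big_geq ?tail_ge0 // ltnW.
have := tail_ge0 n; rewrite /kernel_tail -!(big_mkord xpredT kernel_coef).
rewrite [X in 0 <= 1 - X -> _](big_cat_nat (leq0n m) mn) /=; lra.
Qed.

Lemma kernel_tail_cvg0 (e : R) : 0 < e ->
  exists n0, forall n, (n0 <= n)%N -> kernel_tail n < e.
Proof.
move=> e0.
have [|N0 hN0] := @asin_gap_cvg0 R e; first by [].
exists (2 * N0 + 3)%N => n nn.
have h := hN0 _ (leqnn N0).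
apply: (@le_lt_trans _ _ (kernel_tail (2 * N0 + 3))).
  rewrite /kernel_tail lerD2l lerN2.
  rewrite -!(big_mkord xpredT kernel_coef) [leRHS](big_cat_nat (leq0n _) nn) //= lerDl.
  by apply: sumr_ge0 => i _; rewrite ltW // kernel_coef_gt0.
rewrite kernel_tail_odd ltr_pdivrMr ?pi_gt0 //.
apply: (le_lt_trans h); rewrite -[ltLHS]mulr1 ltr_pM2l //.
by have := pi_ge2 R; lra.
Qed.

(** At length 2N + 3 the error is (1 + t) / 2 <= 1 times the arcsine error over pi. Length n is
    compared with 2n + 3, each term in between being at most its coefficient. *)
Lemma kernel_series_bound n (t : R) : -1 <= t <= 1 ->
  `|kernel t - \sum_(i < n) kernel_coef i * t ^+ i| <= kernel_tail n.
Proof.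
move=> t1.
have p0 : 0 < pi :> R := pi_gt0 R.
have odd_bound N : `|kernel t - \sum_(i < 2 * N + 3) kernel_coef i * t ^+ i|
    <= kernel_tail (2 * N + 3).
  rewrite kernel_psum kernel_tail_odd.
  (* This is arcsin t. *)
  pose th := pi / 2 - acos t.
  have sth : sin th = t.
    by rewrite -cosBpihalf -cosN /th opprB subKr acosK // in_itv.
  have thb : - (pi / 2) <= th <= pi / 2.
    by have := acos_ge0 t1; have := acos_lepi t1; rewrite /th; lra.
  have := asin_psum_bound N thb; rewrite sth => hb.
  rewrite (_ : _ - _ = (1 + t) / 2 * ((th - asin_psum N.+1 t) / pi)); last first.
    by rewrite /kernel /th; have := lt0r_neq0 p0; move: (@pi R) => p p0'; field.
  rewrite normrM [X in X * _]ger0_norm; last by lra.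
  rewrite normrM [`|pi^-1|]ger0_norm ?invr_ge0 ?(ltW p0) //.
  rewrite -[leRHS]mul1r ler_pM ?mulr_ge0 ?invr_ge0 ?(ltW p0) //; [lra|lra|].
  by rewrite ler_wpM2r // invr_ge0 ltW.
have nn : (n <= 2 * n + 3)%N by lia.
have := odd_bound n.
set S1 := \sum_(i < _) _ => hS1; set S := \sum_(i < _) _.
have S1E : S1 = S + \sum_(n <= i < 2 * n + 3) kernel_coef i * t ^+ i.
  by rewrite /S1 /S -!(big_mkord xpredT (fun i => kernel_coef i * t ^+ i)) (big_cat_nat (leq0n _) nn).
rewrite (_ : kernel t - S = (kernel t - S1) + (S1 - S)); last by ring.
apply: (le_trans (ler_normD _ _)).
have -> : kernel_tail n = kernel_tail (2 * n + 3) + \sum_(n <= i < 2 * n + 3) kernel_coef i.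
  rewrite /kernel_tail -!(big_mkord xpredT kernel_coef) [X in 1 - X + _](big_cat_nat (leq0n _) nn) //=.
  by ring.
rewrite lerD // S1E addrC addKr (le_trans (ler_norm_sum _ _ _)) //.
apply: ler_sum => i _; rewrite normrM gtr0_norm ?kernel_coef_gt0 //.
rewrite ler_piMr ?(ltW (kernel_coef_gt0 _)) // normrX exprn_ile1 // ler_norml.
by move: t1; lra.
Qed.

End KernelSeries.

(** * Differential calculus on polynomials *)

Section PolynomialCalculus.
Context {R : realType} {d : nat}.
Implicit Types (p q f g : mpoly d R) (i j : 'I_d) (x : 'I_d -> R).

Local Notation "''x_' i" := (mpolyX R (mnm1 i)) (at level 8, i at level 2).
Local Notation "''d_' i" := (@mderiv d R i) (at level 8, i at level 2).
Local Notation "c %:K" := (mpolyC d c) (at level 1, format "c %:K").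

(** One derivation serves three purposes: c = X gives the Euler operator, constant c a directional
    derivative, and c the gradient of p the cross term of [lapM]. *)
Definition vderiv (c : 'I_d -> mpoly d R) p : mpoly d R :=
  \sum_(i < d) c i * 'd_i p.
Definition euler p := vderiv (fun i => 'x_i) p.
Definition dirderiv x p := vderiv (fun i => (x i)%:K) p.
Definition lap p : mpoly d R := \sum_(i < d) 'd_i ('d_i p).
Definition linform x : mpoly d R := \sum_(i < d) (x i)%:K * 'x_i.
Definition sqnorm : mpoly d R := \sum_(i < d) 'x_i * 'x_i.

Lemma mderiv_sum i (F : 'I_d -> mpoly d R) :
  'd_i (\sum_(j < d) F j) = \sum_(j < d) 'd_i (F j).
Proof. exact: raddf_sum. Qed.

Lemma mderivXU i j : 'd_i ('x_j) = (i == j)%:R.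
Proof.
rewrite mderivX mnm1E eq_sym; case: eqP => [->|_].
  by rewrite scale1r -{1}[mnm1 j]add0m addmK mpolyX0.
by rewrite scale0r.
Qed.

Lemma vderivM c p q : vderiv c (p * q) = vderiv c p * q + p * vderiv c q.
Proof.
rewrite /vderiv mulr_suml mulr_sumr -big_split; apply: eq_bigr => i _ /=.
rewrite mderivM; ring.
Qed.

Lemma vderivD c p q : vderiv c (p + q) = vderiv c p + vderiv c q.
Proof.
by rewrite -big_split; apply: eq_bigr => i _ /=; rewrite mderivD; ring.
Qed.

Lemma vderivB c p q : vderiv c (p - q) = vderiv c p - vderiv c q.
Proof.
by rewrite -sumrB; apply: eq_bigr => i _ /=; rewrite mderivB; ring.
Qed.

Lemma vderivC c a : vderiv c a%:K = 0.
Proof. by rewrite /vderiv big1 // => i _; rewrite mderivC mulr0. Qed.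

Lemma vderivZ c a p : vderiv c (a%:K * p) = a%:K * vderiv c p.
Proof. by rewrite vderivM vderivC mul0r add0r. Qed.

Lemma vderiv1 c : vderiv c 1 = 0.
Proof. by rewrite -mpolyC1 vderivC. Qed.

Lemma vderivXn c p n : vderiv c (p ^+ n) = n%:R * p ^+ n.-1 * vderiv c p.
Proof.
elim: n => [|n IH]; first by rewrite expr0 vderiv1 !mul0r.
rewrite exprS vderivM IH; case: n {IH} => [|n] /=; first by ring.
rewrite exprS; ring.
Qed.

Lemma mderiv_linform i x :
  'd_i (linform x) = (x i)%:K.
Proof.
rewrite raddf_sum (bigD1 i) //= big1 ?addr0 => [|j ji].
  by rewrite mderivM mderivC mderivXU eqxx mul0r add0r mulr1.
by rewrite mderivM mderivC mderivXU eq_sym (negbTE ji) mul0r add0r mulr0.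
Qed.

Lemma mderiv_sqnorm i : 'd_i sqnorm = 2 * 'x_i.
Proof.
rewrite raddf_sum (bigD1 i) //= big1 ?addr0 => [|j ji].
  by rewrite mderivM mderivXU eqxx mul1r mulr1 -mulr2n mulr_natl.
by rewrite mderivM mderivXU eq_sym (negbTE ji) mul0r mulr0 addr0.
Qed.

Lemma vderiv_linform c x : vderiv c (linform x) = \sum_(i < d) (x i)%:K * c i.
Proof. by apply: eq_bigr => i _; rewrite mderiv_linform mulrC. Qed.

Lemma vderiv_sqnorm c : vderiv c sqnorm = 2 * \sum_(i < d) 'x_i * c i.
Proof.
by rewrite mulr_sumr; apply: eq_bigr => i _; rewrite mderiv_sqnorm; ring.
Qed.

Lemma lapM p q :
  lap (p * q) = lap p * q + 2 * vderiv (fun i => 'd_i p) q + p * lap q.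
Proof.
rewrite /lap /vderiv mulr_suml !mulr_sumr -!big_split; apply: eq_bigr => i _ /=.
rewrite !(mderivM, mderivD); ring.
Qed.

Lemma lapB p q : lap (p - q) = lap p - lap q.
Proof. by rewrite -sumrB; apply: eq_bigr => i _; rewrite !mderivB. Qed.

Lemma lapZ a p : lap (a%:K * p) = a%:K * lap p.
Proof.
by rewrite mulr_sumr; apply: eq_bigr => i _; rewrite !mderiv_mulC.
Qed.

Lemma lap1 : lap 1 = 0.
Proof. by rewrite /lap big1 // => i _; rewrite -mpolyC1 mderivC mderiv0. Qed.

Lemma lap_linform x : lap (linform x) = 0.
Proof. by rewrite /lap big1 // => i _; rewrite mderiv_linform mderivC. Qed.

Lemma lap_sqnorm : lap sqnorm = (2 * d)%:R.
Proof.
rewrite /lap; under eq_bigr => i _.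
  rewrite (_ : 'd_i ('d_i sqnorm) = 2); last first.
    by rewrite mderiv_sqnorm -mpolyC_nat mderiv_mulC mderivXU eqxx mulr1.
  over.
by rewrite sumr_const card_ord -mulrnA.
Qed.

Lemma lap_dirderiv x p : lap (dirderiv x p) = dirderiv x (lap p).
Proof.
rewrite /lap /dirderiv /vderiv.
transitivity (\sum_(i < d) \sum_(j < d) (x j)%:K * 'd_i ('d_i ('d_j p))).
  apply: eq_bigr => i _; rewrite !mderiv_sum; apply: eq_bigr => j _ /=.
  by rewrite !mderiv_mulC.
rewrite exchange_big /=; apply: eq_bigr => j _.
rewrite mderiv_sum mulr_sumr; apply: eq_bigr => i _ /=.
by rewrite (mderiv_comm j i p) (mderiv_comm j i).
Qed.

(** Stated by Euler's identity, homogeneity passes to products and derivatives by ring computations.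
    The degree is real, so a - 1 needs no case distinction at 0. *)
Definition homog (a : R) p := euler p = a%:K * p.

Lemma homogM a b p q : homog a p -> homog b q -> homog (a + b) (p * q).
Proof. by rewrite /homog /euler vderivM => -> ->; rewrite mpolyCD; ring. Qed.

Lemma homogD a p q : homog a p -> homog a q -> homog a (p + q).
Proof. by rewrite /homog /euler vderivD => -> ->; ring. Qed.

Lemma homogB a p q : homog a p -> homog a q -> homog a (p - q).
Proof. by rewrite /homog /euler vderivB => -> ->; ring. Qed.

Lemma homogZ a c p : homog a p -> homog a (c%:K * p).
Proof. by rewrite /homog /euler vderivZ => ->; ring. Qed.

Lemma homog1 : homog 0 1.
Proof. by rewrite /homog /euler vderiv1 mpolyC0 mul0r. Qed.

Lemma homogXn a p n : homog a p -> homog (n%:R * a) (p ^+ n).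
Proof.
move=> hp; elim: n => [|n IH]; first by rewrite mul0r expr0; apply: homog1.
by rewrite exprS (_ : _ * a = a + n%:R * a); [apply: homogM|rewrite mulrSr; ring].
Qed.

Lemma homog_linform x : homog 1 (linform x).
Proof. by rewrite /homog /euler vderiv_linform mpolyC1 mul1r. Qed.

Lemma homog_sqnorm : homog 2 sqnorm.
Proof. by rewrite /homog /euler vderiv_sqnorm mpolyC_nat. Qed.

Lemma homog_mderiv a p i : homog a p -> homog (a - 1) ('d_i p).
Proof.
move=> hp; rewrite /homog.
have : 'd_i (euler p) = 'd_i p + euler ('d_i p).
  rewrite raddf_sum /=; under eq_bigr do rewrite mderivM mderivXU.
  rewrite big_split /= (bigD1 i) //= eqxx mul1r big1 ?addr0 => [|j ji].
    by congr (_ + _); apply: eq_bigr => j _; rewrite mderiv_comm.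
  by rewrite eq_sym (negbTE ji) mul0r.
rewrite hp mderiv_mulC => /eqP; rewrite addrC -subr_eq => /eqP <-.
by rewrite mpolyCB mpolyC1; ring.
Qed.

Lemma homog_dirderiv a p x : homog a p -> homog (a - 1) (dirderiv x p).
Proof.
move=> hp; apply: (big_ind (homog (a - 1))) => [|f g hf hg|i _].
- by rewrite -(mul0r 1) -mpolyC0 /homog /euler vderivZ vderiv1; ring.
- exact: homogD.
- exact/homogZ/homog_mderiv.
Qed.

Lemma mcoeff_euler p m : mcoeff m (euler p) = (mdeg m)%:R * mcoeff m p.
Proof.
elim/mpolyind: p => [|c m' p _ _ IH].
  by rewrite /euler -(mul0r 1) -mpolyC0 vderivZ !mul_mpolyC !scale0r !mcoeff0 mulr0.
rewrite /euler -mul_mpolyC vderivD vderivZ !mcoeffD IH mulrDr; congr (_ + _).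
rewrite !mul_mpolyC !mcoeffZ mcoeffX.
suff -> : vderiv (fun i => 'x_i) (mpolyX R m') = (mdeg m')%:R *: mpolyX R m'.
  rewrite mcoeffZ mcoeffX; case: eqP => [->|_]; last by rewrite !mulr0.
  by ring.
rewrite mdegE natr_sum scaler_suml; apply: eq_bigr => i _.
rewrite mderivX -scalerAr -mpolyXD.
case: (posnP (m' i)) => [->|m'i]; first by rewrite !scale0r.
by rewrite addmC submK //; apply/mnm_lepP => j; rewrite mnm1E; case: eqP => // <-.
Qed.

Lemma homogP l p :
  homog l%:R p <-> all (fun m => mdeg m == l) (msupp p).
Proof.
split => [hp|/allP hp].
  apply/allP => m; rewrite mcoeff_msupp => pm.
  have := mcoeff_euler p m; rewrite hp mcoeffCM => /(mulIf pm) /eqP.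
  by rewrite eqr_nat eq_sym.
apply/mpolyP => m; rewrite mcoeff_euler mcoeffCM.
case: (boolP (m \in msupp p)) => [/hp /eqP ->//|].
by rewrite -mcoeff_eq0 => /eqP ->; rewrite !mulr0.
Qed.

Lemma meval_linform v x : meval v (linform x) = \sum_(i < d) x i * v i.
Proof.
by rewrite raddf_sum; apply: eq_bigr => i _ /=; rewrite mevalM mevalC mevalXU.
Qed.

Lemma meval_sqnorm v : meval v sqnorm = \sum_(i < d) v i * v i.
Proof.
by rewrite raddf_sum; apply: eq_bigr => i _ /=; rewrite mevalM mevalXU.
Qed.

(** At the point x, the derivative along x is the Euler operator. *)
Lemma meval_dirderiv_self a p x : homog a p ->
  meval x (dirderiv x p) = a * meval x p.
Proof.
move=> /(congr1 (meval x)); rewrite mevalM mevalC => <-.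
rewrite !raddf_sum; apply: eq_bigr => i _ /=.
by rewrite !mevalM mevalC mevalXU.
Qed.

End PolynomialCalculus.

(** * Zonal harmonics as polynomials *)

Section Zonal.
Context {R : realType} {d : nat}.
Hypothesis d_gt1 : (1 < d)%N.
Variable x : 'I_d -> R.
Hypothesis x_unit : \sum_(i < d) x i * x i = 1.
Implicit Types (p q : mpoly d R).

Local Notation "c %:K" := (mpolyC d c) (at level 1, format "c %:K").

Definition harmonic l p := homog l%:R p /\ lap p = 0 :> mpoly d R.

Lemma harmonic_dirderiv l p (y : 'I_d -> R) :
  harmonic l.+1 p -> harmonic l (dirderiv y p).
Proof.
move=> [hp Lp]; split.
  by rewrite (_ : l%:R = l.+1%:R - 1); [exact: homog_dirderiv|rewrite mulrSr; ring].
rewrite lap_dirderiv Lp /dirderiv -(mul0r 1) -mpolyC0 vderivZ vderiv1; ring.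
Qed.

Lemma dirderiv_linform : dirderiv x (linform x) = 1 :> mpoly d R.
Proof.
rewrite /dirderiv vderiv_linform; under eq_bigr do rewrite -mpolyCM.
by rewrite -mpolyC1 -x_unit; symmetry; apply: raddf_sum.
Qed.

Lemma vderiv_mderiv_linform p :
  vderiv (fun i => mderiv i (linform x)) p = dirderiv x p.
Proof. by apply: eq_bigr => i _; rewrite mderiv_linform. Qed.

Lemma lap_linformXn n :
  lap (linform x ^+ n) = (n * n.-1)%:R * linform x ^+ n.-2 :> mpoly d R.
Proof.
elim: n => [|n IH]; first by rewrite expr0 lap1 mul0r.
rewrite exprS lapM lap_linform IH vderiv_mderiv_linform.
rewrite /dirderiv vderivXn -/(dirderiv x _) dirderiv_linform.
case: n {IH} => [|[|n]] /=; rewrite ?expr0 ?expr1.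
- by ring.
- by ring.
rewrite [in X in _ + X]mulrCA -exprS /=; ring.
Qed.

(** The Legendre recurrence made homogeneous: t becomes <x, X> and the lower term is multiplied by
    |X|^2, which is 1 on the sphere. The result is the solid harmonic |X|^l P_l(<x, X> / |X|). *)
Fixpoint zonal_pair (l : nat) : mpoly d R * mpoly d R :=
  match l with
  | 0 => (1, linform x)
  | l'.+1 =>
      let pr := zonal_pair l' in
      (pr.2, ((l'.+1 + d - 2)%N%:R^-1)%:K *
             ((2 * l'.+1 + d - 2)%:R * linform x * pr.2
              - l'.+1%:R * sqnorm * pr.1))
  end.
Definition zonal l := (zonal_pair l).1.

Lemma zonal0 : zonal 0 = 1. Proof. by []. Qed.
Lemma zonal1 : zonal 1 = linform x. Proof. by []. Qed.

Lemma zonalSS l : zonal l.+2 = ((l.+1 + d - 2)%N%:R^-1)%:K *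
  ((2 * l.+1 + d - 2)%:R * linform x * zonal l.+1 - l.+1%:R * sqnorm * zonal l).
Proof. by []. Qed.

Lemma zonal_ind (Q : nat -> Prop) :
  Q 0 -> Q 1 -> (forall l, Q l -> Q l.+1 -> Q l.+2) -> forall l, Q l.
Proof.
move=> Q0 Q1 QS l; suff [] : Q l /\ Q l.+1 by [].
by elim: l => // l [Ql QSl]; split => //; exact: QS.
Qed.

Lemma meval_zonal v l : \sum_(i < d) v i * v i = 1 ->
  meval v (zonal l) = legendreP d l (\sum_(i < d) x i * v i).
Proof.
move=> v1; elim/zonal_ind: l => [||l IH IH1].
- by rewrite zonal0 meval1.
- by rewrite zonal1 meval_linform.
rewrite zonalSS mevalM mevalC mevalB !mevalM IH IH1 meval_linform meval_sqnorm.
rewrite v1 -!mpolyC_nat !mevalC mulr1 mulrC; congr (_ / _).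
Qed.

Lemma homog_zonal l : homog l%:R (zonal l).
Proof.
elim/zonal_ind: l => [||l IH IH1].
- exact: homog1.
- exact: homog_linform.
rewrite zonalSS; apply/homogZ/homogB; rewrite -mulrA -mpolyC_nat; apply/homogZ.
  by rewrite -natr1 addrC; apply: homogM => //; exact: homog_linform.
by rewrite -(addn2 l) natrD addrC; apply: homogM => //; exact: homog_sqnorm.
Qed.

(** Differentiating the recurrence produces |X|^2 times the derivative of [zonal l], so an identity
    for that product is proved simultaneously. It in turn follows, one degree higher, from the first
    identity and the recurrence. *)
Lemma dirderiv_zonal l : dirderiv x (zonal l.+1) = l.+1%:R * zonal l.
Proof.
suff [] : dirderiv x (zonal l.+1) = l.+1%:R * zonal l /\
  sqnorm * dirderiv x (zonal l) = (2 * l%:R + d%:R - 2) * linform x * zonal l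
     - (l%:R + d%:R - 2) * zonal l.+1 by [].
elim: l => [|l [IHd IHr]].
  rewrite zonal0 zonal1 dirderiv_linform /dirderiv vderiv1; split; ring.
(* The denominator of the recurrence is l + d - 1; inserting this product as a factor 1 replaces
   division in the polynomial ring. *)
have W1 : ((l.+1 + d - 2)%N%:R^-1)%:K * (l%:R + d%:R - 1) = 1 :> mpoly d R.
  rewrite (_ : _ - 1 = ((l.+1 + d - 2)%N%:R : R)%:K).
    by rewrite -mpolyCM mulVf ?mpolyC1 // pnatr_eq0; lia.
  rewrite mpolyC_nat (_ : (_ - 2)%N = (l + d.-1)%N); last by lia.
  have -> : d%:R = d.-1%:R + 1 :> mpoly d R.
    by rewrite natr1 prednK // ltnW.
  by rewrite natrD; ring.
have e2 : (2 * l.+1 + d - 2)%:R = 2 * l%:R + d%:R :> mpoly d R.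
  by rewrite (_ : (_ - 2)%N = (2 * l + d)%N); [rewrite natrD natrM|lia].
split; last first.
  rewrite IHd zonalSS e2.
  set W := mpolyC _ _ in W1 *.
  set T := (X in W * X).
  rewrite (_ : _ * (W * T) = W * (l%:R + d%:R - 1) * T); last first.
    by rewrite mulrSr; ring.
  by rewrite W1 /T !mulrSr; ring.
rewrite zonalSS e2 /dirderiv vderivZ vderivB.
rewrite -!mpolyC_nat -(mpolyCM _ 2) -(mpolyCD _ _ d%:R) -!mulrA !vderivZ.
rewrite mpolyCD mpolyCM !mpolyC_nat !vderivM.
rewrite -/(dirderiv x _) -/(dirderiv x _) dirderiv_linform IHd vderiv_sqnorm.
rewrite (_ : \sum_(i < d) _ = linform x); last first.
  by apply: eq_bigr => i _; rewrite mulrC.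
set W := mpolyC _ _ in W1 *; rewrite -/(dirderiv x _).
rewrite mulrDr IHr.
rewrite (_ : l.+2%:R * zonal l.+1 = W * (l%:R + d%:R - 1) * (l.+2%:R * zonal l.+1)).
  by rewrite -(addn2 l) !mulrSr natrD; ring.
by rewrite W1 mul1r.
Qed.

(** The Laplacian of <x, X> Z_(l+1) is 2 (l + 1) Z_l by [dirderiv_zonal], that of |X|^2 Z_l is (2d +
    4l) Z_l by Euler; the weights 2l + d and l + 1 of the recurrence cancel them. *)
Lemma lap_zonal l : lap (zonal l) = 0.
Proof.
elim/zonal_ind: l => [||l IH IH1].
- exact: lap1.
- exact: lap_linform.
have e2 : (2 * l.+1 + d - 2)%:R = 2 * l%:R + d%:R :> mpoly d R.
  by rewrite (_ : (_ - 2)%N = (2 * l + d)%N); [rewrite natrD natrM|lia].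
rewrite zonalSS e2 lapZ lapB -!mpolyC_nat -(mpolyCM _ 2) -(mpolyCD _ _ d%:R).
rewrite -!mulrA !lapZ !lapM IH IH1 lap_linform lap_sqnorm vderiv_mderiv_linform.
rewrite dirderiv_zonal (_ : vderiv _ (zonal l) = 2 * (l%:R * zonal l)).
  by rewrite mpolyCD mpolyCM !mpolyC_nat natrM; ring.
have := homog_zonal l; rewrite /homog mpolyC_nat => <-.
by rewrite mulr_sumr; apply: eq_bigr => i _; rewrite mderiv_sqnorm mulrA.
Qed.

Lemma harmonic_zonal l : harmonic l (zonal l).
Proof. by split; [exact: homog_zonal|exact: lap_zonal]. Qed.

End Zonal.

(** * Funk-Hecke formula *)

Lemma mulf_divKM (F : fieldType) (D a b : F) : D != 0 -> D * (a / D * b) = a * b.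
Proof. by move=> D0; rewrite mulrA (mulrC D) divfK. Qed.

Definition lam_diag {R : realType} (d l : nat) : R :=
  l`!%:R / \prod_(i < l) (d + 2 * i)%:R.

(* [lam d n l] is the factor by which integration against <x, .>^n acts on
   harmonics of degree l; it vanishes unless n - l is even and nonnegative. *)
Fixpoint lam {R : realType} (d n l : nat) : R :=
  match n with
  | 0 | 1 => if l == n then lam_diag d l else 0
  | n'.+2 => if l == n then lam_diag d l else
      (n * n.-1)%:R / ((n%:R - l%:R) * (n + l + d - 2)%:R) * lam d n' l
  end.

Lemma lam_diagS {R : realType} d l :
  lam_diag d l.+1 = lam_diag d l * l.+1%:R / (d + 2 * l)%:R :> R.
Proof.
rewrite /lam_diag factS natrM big_ord_recr /= invfM; ring.
Qed.

Lemma lam_diag_ge0 {R : realType} d l : 0 <= lam_diag d l :> R.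
Proof. by rewrite divr_ge0 // prodr_ge0. Qed.

Lemma lamnn {R : realType} d l : lam d l l = lam_diag d l :> R.
Proof. by case: l => [|[|l]] /=; rewrite ?eqxx. Qed.

Lemma lamSS {R : realType} d n l : l != n.+2 -> lam d n.+2 l =
  (n.+2 * n.+1)%:R / ((n.+2%:R - l%:R) * (n.+2 + l + d - 2)%:R) * lam d n l :> R.
Proof. by move=> /negbTE /= ->. Qed.

Lemma lam_lt {R : realType} d n l : (n < l)%N -> lam d n l = 0 :> R.
Proof.
elim/zonal_ind: n => [||n IH _] nl.
- by rewrite /= gtn_eqF.
- by rewrite /= gtn_eqF.
by rewrite lamSS ?gtn_eqF // IH ?mulr0 // ltnW // ltnW.
Qed.

Lemma lam_ge0 {R : realType} d n l : 0 <= lam d n l :> R.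
Proof.
elim/zonal_ind: n => [||n IH _].
- by rewrite /=; case: ifP => // _; exact: lam_diag_ge0.
- by rewrite /=; case: ifP => // _; exact: lam_diag_ge0.
have [ln|nl|<-] := ltngtP l n.+2; last by rewrite lamnn lam_diag_ge0.
  rewrite lamSS ?ltn_eqF // mulr_ge0 // divr_ge0 // mulr_ge0 //.
  by rewrite subr_ge0 ler_nat ltnW.
by rewrite lam_lt.
Qed.

(** The recurrence factor (n+2)(n+1) / ((n+2-l)(n+l+d)) is at most 1 iff l (d-2) + l^2 <=
    (n+2)(d-1), which holds for n >= l once d >= l^2 + 2. *)
Lemma lam_le_diag {R : realType} d n l : (l * l + 2 <= d)%N ->
  lam d n l <= lam_diag d l :> R.
Proof.
move=> ld; elim/zonal_ind: n => [||n IH _].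
- by rewrite /=; case: ifP => // _; exact: lam_diag_ge0.
- by rewrite /=; case: ifP => // _; exact: lam_diag_ge0.
have [ln|nl|<-] := ltngtP l n.+2; last by rewrite lamnn.
  have [ln'|nl'] := leqP l n; last first.
    by rewrite lamSS ?ltn_eqF // lam_lt ?mulr0 ?lam_diag_ge0.
  rewrite lamSS ?ltn_eqF // (le_trans _ IH) // ler_piMl ?lam_ge0 //.
  rewrite -natrB ?(ltnW ln) // -natrM ler_pdivrMr ?ltr0n ?mul1r ?ler_nat.
    have [j jE] : exists j, n = (l + j)%N by exists (n - l)%N; lia.
    have [e eE] : exists e, d = (l * l + 2 + e)%N by exists (d - (l * l + 2))%N; lia.
    rewrite jE eE; nia.
  by rewrite muln_gt0; lia.
by rewrite lam_lt ?lam_diag_ge0.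
Qed.

Lemma lam_diag_ub {R : realType} d l : (0 < d)%N ->
  lam_diag d l <= l`!%:R * d%:R ^- l :> R.
Proof.
move=> d0; rewrite ler_wpM2l // lef_pV2 ?posrE ?exprn_gt0 ?ltr0n //; last first.
  by apply: prodr_gt0 => i _; rewrite ltr0n; lia.
rewrite -[X in _ ^+ X]card_ord -prodr_const ler_prod // => i _.
by rewrite ler0n ler_nat leq_addr.
Qed.

(** Each factor d + 2i with i < l is at most (2l + 1) d. *)
Lemma lam_diag_lb {R : realType} d l : (0 < d)%N ->
  (2 * l + 1)%:R ^- l * d%:R ^- l <= lam_diag d l :> R.
Proof.
move=> d0; rewrite -invfM -exprMn -natrM.
apply: (@le_trans _ _ (1 / \prod_(i < l) (d + 2 * i)%:R)); last first.
  by rewrite ler_wpM2r ?ler1n ?fact_gt0 // invr_ge0 prodr_ge0.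
rewrite mul1r lef_pV2 ?posrE ?exprn_gt0 ?ltr0n ?muln_gt0 ?d0 ?addn1 //; last first.
  by apply: prodr_gt0 => i _; rewrite ltr0n; lia.
rewrite -[X in _ ^+ X]card_ord -prodr_const ler_prod // => i _.
rewrite ler0n ler_nat; have := ltn_ord i; nia.
Qed.

(** * Green's formula and moments for an abstract mean on polynomials *)

Section SphericalMean.
Context {R : realType} {d : nat}.
Hypothesis d_gt1 : (1 < d)%N.
Variable E : mpoly d R -> R.
Hypothesis ED : forall p q, E (p + q) = E p + E q.
Hypothesis EZ : forall a p, E (mpolyC d a * p) = a * E p.
Hypothesis E_sphere : forall p, E (sqnorm * p) = E p.
Hypothesis E1 : E 1 = 1.
Hypothesis E_rot : forall i j p,
  E (mpolyX R (mnm1 i) * mderiv j p - mpolyX R (mnm1 j) * mderiv i p) = 0.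
Implicit Types (p q f g : mpoly d R) (i j : 'I_d) (x : 'I_d -> R).

Local Notation "''x_' i" := (mpolyX R (mnm1 i)) (at level 8, i at level 2).
Local Notation "''d_' i" := (@mderiv d R i) (at level 8, i at level 2).
Local Notation "c %:K" := (mpolyC d c) (at level 1, format "c %:K").

Lemma mean0 : E 0 = 0.
Proof. by rewrite -[X in E X](mul0r 1) -mpolyC0 EZ mul0r. Qed.

Lemma meanN p : E (- p) = - E p.
Proof.
by rewrite -mulN1r -mpolyC1 -mpolyCN EZ mulN1r.
Qed.

Lemma meanB p q : E (p - q) = E p - E q.
Proof. by rewrite ED meanN. Qed.

Lemma mean_sum n (F : 'I_n -> mpoly d R) :
  E (\sum_(i < n) F i) = \sum_(i < n) E (F i).
Proof. exact: (big_morph E ED mean0). Qed.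

(* The divergence theorem on the ball, for homogeneous vector fields: sum the
   rotation invariance of [X_i h_j] over all pairs [(i, j)]. *)
Lemma mean_div a (h : 'I_d -> mpoly d R) : (forall j, homog a (h j)) ->
  E (\sum_(j < d) 'd_j (h j)) = (d%:R - 1 + a) * E (\sum_(j < d) 'x_j * h j).
Proof.
move=> hh.
have : E (\sum_(i < d) \sum_(j < d)
    ('x_i * 'd_j ('x_i * h j) - 'x_j * 'd_i ('x_i * h j))) = 0.
  by rewrite mean_sum big1 // => i _; rewrite mean_sum big1.
have -> : \sum_(i < d) \sum_(j < d)
    ('x_i * 'd_j ('x_i * h j) - 'x_j * 'd_i ('x_i * h j)) =
    sqnorm * (\sum_(j < d) 'd_j (h j))
    - (d%:R - 1 + a)%:K * \sum_(j < d) 'x_j * h j.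
  rewrite /sqnorm mulr_suml.
  transitivity (\sum_(i < d) ('x_i * 'x_i * \sum_(j < d) 'd_j (h j) + 'x_i * h i)
      - \sum_(i < d) \sum_(j < d) ('x_j * h j + 'x_j * ('x_i * 'd_i (h j)))).
    rewrite -sumrB; apply: eq_bigr => i _; rewrite mulr_sumr.
    rewrite (_ : 'x_i * h i = \sum_(j < d) (i == j)%:R * ('x_i * h j)); last first.
      rewrite (bigD1 i) //= eqxx mul1r big1 ?addr0 // => j.
      by rewrite eq_sym => /negbTE ->; rewrite mul0r.
    rewrite -big_split -sumrB; apply: eq_bigr => j _ /=.
    rewrite !mderivM !mderivXU eqxx mul1r eq_sym; ring.
  rewrite big_split /= exchange_big /=.
  under [X in _ - X]eq_bigr => j _.
    rewrite big_split /= sumr_const card_ord -mulr_sumr.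
    rewrite (_ : \sum_(i < d) 'x_i * 'd_i (h j) = a%:K * h j); last exact: hh.
    rewrite (_ : _ + _ = (d%:R + a)%:K * ('x_j * h j)); last first.
      by rewrite mpolyCD mpolyC_nat -mulr_natl; ring.
    over.
  rewrite -[X in _ - X]mulr_sumr -addrA; congr (_ + _).
  by rewrite !mpolyCD mpolyCN mpolyC_nat mpolyC1; ring.
by rewrite meanB E_sphere EZ => /eqP; rewrite subr_eq0 => /eqP.
Qed.

(** This is [mean_div] for the field f grad g - g grad f, homogeneous of degree a + b - 1, whose
    radial component is (b - a) f g by Euler. *)
Lemma mean_green a b f g : homog a f -> homog b g ->
  E (f * lap g - g * lap f) = (a + b + d%:R - 2) * (b - a) * E (f * g).
Proof.
move=> hf hg.
have hh j : homog (a + b - 1) (f * 'd_j g - g * 'd_j f).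
  apply: homogB.
    by rewrite -addrA; apply/homogM => //; exact: homog_mderiv.
  by rewrite (addrC a) -addrA; apply/homogM => //; exact: homog_mderiv.
have := mean_div hh.
rewrite [in LHS](_ : \sum_(j < d) _ = f * lap g - g * lap f); last first.
  rewrite /lap !mulr_sumr -sumrB; apply: eq_bigr => j _.
  by rewrite mderivB !mderivM; ring.
rewrite [in RHS](_ : \sum_(j < d) _ = (b - a)%:K * (f * g)); last first.
  rewrite mpolyCB mulrBl.
  rewrite (_ : b%:K * (f * g) = f * (b%:K * g)); last by ring.
  rewrite (_ : a%:K * (f * g) = g * (a%:K * f)); last by ring.
  rewrite -hf -hg !mulr_sumr -sumrB; apply: eq_bigr => j _; ring.
by move=> ->; rewrite EZ; ring.
Qed.

(** Green's formula leaves (l + m + d - 2)(m - l) E(f g) = 0; for d >= 2 the first factor vanishes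
    only if l = m = 0. *)
Lemma mean_harmonic_orth l m f g : l != m ->
  harmonic l f -> harmonic m g -> E (f * g) = 0.
Proof.
move=> lm [hf Lf] [hg Lg].
have := mean_green hf hg; rewrite Lf Lg !mulr0 subr0 mean0 => /esym /eqP.
rewrite !mulf_eq0 !subr_eq0 -!natrD !eqr_nat (eq_sym m) (negbTE lm) orbF.
case/orP => [h|/eqP //]; exfalso; move: h lm d_gt1; lia.
Qed.

Lemma mean_dirderiv a f x : homog a f ->
  E (dirderiv x f) = (d%:R - 1 + a) * E (linform x * f).
Proof.
move=> hf.
have hh j : homog a ((x j)%:K * f) by exact: homogZ.
have := mean_div hh; rewrite [in LHS](_ : \sum_(j < d) _ = dirderiv x f).
  move=> ->; congr (_ * E _).
  by rewrite /linform mulr_suml; apply: eq_bigr => j _; ring.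
by apply: eq_bigr => j _; rewrite mderiv_mulC.
Qed.

(** For n < 2 the truncated exponent [n.-2] is harmless, since [n * n.-1] is 0. *)
Lemma mean_linformXn_rec n l q x : \sum_(i < d) x i * x i = 1 -> harmonic l q ->
  (n%:R - l%:R) * (n + l + d - 2)%:R * E (linform x ^+ n * q) =
  (n * n.-1)%:R * E (linform x ^+ n.-2 * q).
Proof.
move=> x1 [hq Lq].
have hx : homog n%:R (linform x ^+ n).
  by rewrite -[n%:R]mulr1; apply/homogXn/homog_linform.
have := mean_green hx hq.
rewrite Lq mulr0 sub0r (lap_linformXn x1) meanN -mpolyC_nat mulrCA EZ.
rewrite (mulrC q) natrB; last by lia.
by rewrite !natrD => h; rewrite -[RHS]opprK h; ring.
Qed.

Lemma mean_linformXn_lt n l q x : \sum_(i < d) x i * x i = 1 -> harmonic l q ->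
  (n < l)%N -> E (linform x ^+ n * q) = 0.
Proof.
move=> x1 hq; elim/zonal_ind: n => [||n IH _] nl; [
  have /eqP := mean_linformXn_rec 0 x1 hq | have /eqP := mean_linformXn_rec 1 x1 hq |
  have /eqP := mean_linformXn_rec n.+2 x1 hq];
  rewrite /= ?IH ?(ltnW (ltnW nl)) // ?muln0 ?mulr0 ?mul0r
    !mulf_eq0 subr_eq0 eqr_nat (ltn_eqF nl) pnatr_eq0 /=;
  case/orP => [h|/eqP //]; exfalso; move: h nl d_gt1; lia.
Qed.

(** Induction through [mean_dirderiv] for <x, X>^l q: the term differentiating the power has too low
    an exponent and vanishes, the other involves the derivative of q, harmonic of degree l, with
    value (l + 1) q(x) at x. *)
Lemma mean_linformXn_diag l q x : \sum_(i < d) x i * x i = 1 -> harmonic l q ->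
  E (linform x ^+ l * q) = lam_diag d l * meval x q.
Proof.
move=> x1; elim: l q => [|l IH] q hq.
  have [/homogP /allP q0 _] := hq.
  have -> : q = (mcoeff (@mnm0 d) q)%:K.
    apply/mpolyP => m; rewrite mcoeffC.
    case: (boolP (m \in msupp q)) => [mq|].
      by have := q0 _ mq; rewrite mdeg_eq0 => /eqP ->; rewrite eqxx mulr1.
    move=> mq; have := mq; rewrite -mcoeff_eq0 => /eqP ->.
    case: eqP => [m0|_]; rewrite ?mulr0 // -m0.
    by move: mq; rewrite -mcoeff_eq0 => /eqP ->; rewrite mul0r.
  rewrite expr0 mul1r mevalC -[X in E X]mulr1 EZ E1 mulrC /lam_diag big_ord0 fact0.
  by rewrite divr1.
have hq' := harmonic_dirderiv x hq.
have hf : homog (l%:R * 1 + l.+1%:R) (linform x ^+ l * q).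
  by apply: homogM; [exact/homogXn/homog_linform|case: hq].
have := mean_dirderiv x hf.
rewrite /dirderiv vderivM vderivXn -/(dirderiv x _) -/(dirderiv x q).
rewrite dirderiv_linform // mulr1 ED -mulrA -mpolyC_nat EZ.
rewrite (mean_linformXn_lt x1 hq) ?mulr0 ?add0r; last by lia.
rewrite IH // (meval_dirderiv_self x (proj1 hq)).
rewrite [linform x * (_ * _)]mulrA -exprS => h.
have d0 : (d + 2 * l)%:R != 0 :> R by rewrite pnatr_eq0; lia.
apply: (mulfI d0); rewrite lam_diagS.
rewrite (_ : (d + 2 * l)%:R = d%:R - 1 + (l%:R * 1 + l.+1%:R)); last first.
  by rewrite natrD natrM mulrSr; ring.
rewrite -h (_ : d%:R - 1 + _ = (d + 2 * l)%:R).
  by rewrite mulf_divKM // mulrA.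
by ring.
Qed.

Lemma funk_hecke_monomial n l q x : \sum_(i < d) x i * x i = 1 ->
  harmonic l q -> E (linform x ^+ n * q) = lam d n l * meval x q.
Proof.
move=> x1 hq.
have [nl|ln|nl] := ltngtP n l; last by rewrite nl lamnn (mean_linformXn_diag x1 hq).
  by rewrite lam_lt // mul0r (mean_linformXn_lt x1 hq).
elim/zonal_ind: n ln => [||n IH _] ln //.
  have := mean_linformXn_rec 1 x1 hq; rewrite muln0 mul0r => /eqP.
  rewrite /= ltn_eqF // mul0r !mulf_eq0 subr_eq0 eqr_nat gtn_eqF // pnatr_eq0.
  by case/orP => [h|/eqP //]; exfalso; move: h d_gt1; lia.
have nz : (n.+2%:R - l%:R) * (n.+2 + l + d - 2)%:R != 0 :> R.
  by apply: mulf_neq0; [rewrite subr_eq0 eqr_nat|rewrite pnatr_eq0]; lia.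
apply: (mulfI nz); rewrite mean_linformXn_rec // lamSS ?ltn_eqF //=.
have -> : E (linform x ^+ n * q) = lam d n l * meval x q.
  have [nl|ln'|nl] := ltngtP n l; last by rewrite nl lamnn (mean_linformXn_diag x1 hq).
    by rewrite lam_lt // mul0r (mean_linformXn_lt x1 hq).
  exact: IH.
by rewrite -[in RHS](mulrA (_ / _)) mulf_divKM.
Qed.

(** In the recurrence for Z_(l+2), the |X|^2 Z_l part is orthogonal to q. The <x, X> Z_(l+1) part
    goes through [mean_dirderiv] to the derivative of q along x, of degree l + 1. Only the
    independence of c from x and q matters here; [addition_theorem] finds its value. *)
Lemma zonal_reproducing l : exists c : R, forall x q,
  \sum_(i < d) x i * x i = 1 -> harmonic l q ->
  E (zonal x l * q) = c * meval x q.
Proof.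
elim/zonal_ind: l => [||l _ [c IH]].
- by exists (lam_diag d 0) => x q x1 hq; rewrite zonal0 -(expr0 (linform x)) mean_linformXn_diag.
- by exists (lam_diag d 1) => x q x1 hq; rewrite zonal1 -[linform x]expr1 mean_linformXn_diag.
exists ((l.+1 + d - 2)%:R^-1 * (2 * l.+1 + d - 2)%:R * (d + 2 * l + 2)%:R^-1 * c * l.+2%:R).
move=> x q x1 hq.
have nz : (d + 2 * l + 2)%:R != 0 :> R by rewrite pnatr_eq0; lia.
have hZ := harmonic_zonal d_gt1 x1.
have hx : E (linform x * (zonal x l.+1 * q)) =
    (d + 2 * l + 2)%:R^-1 * (c * (l.+2%:R * meval x q)).
  apply: (mulfI nz); rewrite mulVKf //.
  have hf : homog (l.+1%:R + l.+2%:R) (zonal x l.+1 * q).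
    by apply: homogM; [case: (hZ l.+1)|case: hq].
  rewrite -(meval_dirderiv_self x (proj1 hq)) -IH //; last exact: harmonic_dirderiv.
  have := mean_dirderiv x hf; rewrite /dirderiv vderivM -/(dirderiv x _) -/(dirderiv x q).
  rewrite dirderiv_zonal // ED -mulrA -mpolyC_nat EZ (@mean_harmonic_orth l l.+2) //.
    rewrite mulr0 add0r => ->; congr (_ * _).
    by ring.
  by lia.
rewrite zonalSS -[_%:K * _ * q]mulrA EZ mulrBl meanB.
rewrite -[_ * linform x * _ * q]mulrA -[_ * linform x * _]mulrA.
rewrite -[_ * sqnorm * _ * q]mulrA -[_ * sqnorm * _]mulrA.
rewrite -!mpolyC_nat !EZ E_sphere hx.
rewrite (@mean_harmonic_orth l l.+2) //; last by lia.
by ring.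
Qed.

End SphericalMean.

(** * Integration over the sphere *)

Section NullSetIntegral.
Context {disp : measure_display} {T : measurableType disp} {R : realType}.
Variables (mu : {measure set T -> \bar R}) (S : set T).
Hypotheses (mS : measurable S) (muS : mu (~` S) = 0%E).
Import HBNNSimple.

Let ge0_le_integral_null (f g : T -> \bar R) : (forall x, 0 <= f x)%E ->
  (forall x, 0 <= g x)%E -> (forall x, S x -> f x = g x) ->
  (\int[mu]_x f x <= \int[mu]_x g x)%E.
Proof.
move=> f0 g0 fg; rewrite !ge0_integralTE //.
apply: ge_ereal_sup => _ [h /= hf <-].
pose h' := proj_nnsfun h mS.
have -> : sintegral mu h = sintegral mu h'.
  rewrite -!integralT_nnsfun; apply: ae_eq_integral => //.
  - exact/measurable_EFinP/measurable_funP.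
  - exact/measurable_EFinP/measurable_funP.
  exists (~` S); split => //; first exact: measurableC.
  move=> x /= hx Sx; apply: hx => _.
  by rewrite /= mindicE mem_set // mulr1.
apply: ereal_sup_ubound; exists h' => //= x; rewrite mindicE.
case: (boolP (x \in S)) => xS; last by rewrite mulr0.
by rewrite mulr1 -fg //; exact: set_mem.
Qed.

(* No measurability is assumed: the integral is a supremum over simple
   functions, and these can be cut off outside [S]. *)
Lemma integral_null (f g : T -> \bar R) : (forall x, S x -> f x = g x) ->
  (\int[mu]_x f x = \int[mu]_x g x)%E.
Proof.
move=> fg; rewrite integralE [RHS]integralE.
have fgp x : S x -> (f^\+ x = g^\+ x)%E by move=> Sx; rewrite !funeposE fg.
have fgn x : S x -> (f^\- x = g^\- x)%E by move=> Sx; rewrite !funenegE fg.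
congr (_ - _)%E; apply/eqP; rewrite eq_le !ge0_le_integral_null // => x Sx.
  by rewrite fgp.
by rewrite fgn.
Qed.

Lemma Rintegral_null (f g : T -> R) : (forall x, S x -> f x = g x) ->
  Rintegral mu setT f = Rintegral mu setT g.
Proof.
by move=> fg; congr fine; apply: integral_null => x Sx; rewrite fg.
Qed.

End NullSetIntegral.

Section SphereIntegral.
Context {R : realType} {d : nat}.
Variable P : probability (d.-tuple R) R.
Hypothesis hP : uniform_sphere_measure P.
Implicit Types (f g : d.-tuple R -> R) (x : d.-tuple R) (p q : mpoly d R).

Local Notation Int f := (Rintegral P setT f).
Local Notation ev p := (fun x : d.-tuple R => meval (tnth x) p).
Local Notation "c %:K" := (mpolyC d c) (at level 1, format "c %:K").
Local Notation "''x_' i" := (mpolyX R (mnm1 i)) (at level 8, i at level 2).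

Lemma mpoly_alg_ind (Q : mpoly d R -> Prop) :
  (forall c, Q c%:K) -> (forall i, Q 'x_i) ->
  (forall p q, Q p -> Q q -> Q (p + q)) ->
  (forall p q, Q p -> Q q -> Q (p * q)) -> forall p, Q p.
Proof.
move=> QC QX QD QM p; rewrite (mpolyE p); apply: (big_ind Q) => [|f g|m _].
- by rewrite -mpolyC0; exact: (QC).
- exact: QD.
rewrite -mul_mpolyC; apply: (QM); first exact: (QC).
rewrite mpolyXE_id; apply: (big_ind Q) => [|f g|i _].
- by rewrite -mpolyC1; exact: (QC).
- exact: (QM).
elim: (m i) => [|n IH]; first by rewrite expr0 -mpolyC1; exact: (QC).
by rewrite exprS; apply: (QM) => //; exact: (QX).
Qed.

Lemma measurable_ev p : measurable_fun setT (ev p).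
Proof.
elim/mpoly_alg_ind: p => [c|i|p q hp hq|p q hp hq].
- by under eq_fun do rewrite mevalC; exact: measurable_cst.
- by under eq_fun do rewrite mevalXU; exact: measurable_tnth.
- by under eq_fun do rewrite mevalD; exact: measurable_funD.
- by under eq_fun do rewrite mevalM; exact: measurable_funM.
Qed.

Lemma meval_sqnorm_dotp x : meval (tnth x) sqnorm = dotp x x.
Proof. by rewrite meval_sqnorm. Qed.

Lemma measurable_sphere : measurable (sphere d : set (d.-tuple R)).
Proof.
have := @measurable_ev sqnorm measurableT [set 1] (measurable_set1 _).
rewrite setTI; congr measurable; apply/seteqP.
by split => x /=; rewrite meval_sqnorm_dotp.
Qed.

Lemma sphere_coord_le1 x i : sphere d x -> `|tnth x i| <= 1.
Proof.
rewrite /sphere /= /dotp (bigD1 i) //= => h.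
rewrite -(@expr_le1 _ 2) //.
rewrite real_normK ?num_real // expr2 -h lerDl.
by apply: sumr_ge0 => j _; rewrite -expr2 sqr_ge0.
Qed.

Lemma ev_bounded p : exists2 M, 0 <= M &
  forall x, sphere d x -> `|meval (tnth x) p| <= M.
Proof.
elim/mpoly_alg_ind: p => [c|i|p q [M M0 hp] [N N0 hq]|p q [M M0 hp] [N N0 hq]].
- by exists `|c| => // x _; rewrite mevalC.
- by exists 1 => // x Sx; rewrite mevalXU sphere_coord_le1.
- exists (M + N) => [|x Sx]; first exact: addr_ge0.
  by rewrite mevalD (le_trans (ler_normD _ _)) // lerD ?hp ?hq.
- exists (M * N) => [|x Sx]; first exact: mulr_ge0.
  by rewrite mevalM normrM ler_pM ?hp ?hq.
Qed.

Lemma Int_eq f g : (forall x, sphere d x -> f x = g x) -> Int f = Int g.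
Proof. exact: Rintegral_null measurable_sphere (proj1 hP) _ _. Qed.

(** The measure lives on R^d, where polynomials are unbounded and harmonics are arbitrary off the
    sphere; hence a bounded measurable representative instead of f itself. *)
Definition sphere_regular f := exists g, [/\ measurable_fun setT g,
  exists M, forall x, `|g x| <= M & forall x, sphere d x -> f x = g x].

Lemma sphere_regularP f M : measurable_fun setT (fun x => f x * \1_(sphere d) x) ->
  (forall x, sphere d x -> `|f x| <= M) -> sphere_regular f.
Proof.
move=> mf fM; exists (fun x => f x * \1_(sphere d) x); split => //.
  exists `|M| => x; rewrite indicE; case: (boolP (x \in _)) => [|_].
    by rewrite inE mulr1 => /fM /le_trans; apply; exact: ler_norm.
  by rewrite mulr0 normr0.
by move=> x Sx; rewrite indicE mem_set // mulr1.
Qed.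

Lemma regular_ev p : sphere_regular (ev p).
Proof.
have [M _ hM] := ev_bounded p; apply: (@sphere_regularP _ M) => //.
apply: measurable_funM; first exact: measurable_ev.
by apply: measurable_indic; exact: measurable_sphere.
Qed.

Lemma regularD f g : sphere_regular f -> sphere_regular g ->
  sphere_regular (fun x => f x + g x).
Proof.
move=> [f' [mf [M hM] ff]] [g' [mg [N hN] gg]].
exists (fun x => f' x + g' x); split; first exact: measurable_funD.
  by exists (M + N) => x; rewrite (le_trans (ler_normD _ _)) // lerD.
by move=> x Sx; rewrite ff // gg.
Qed.

Lemma regularM f g : sphere_regular f -> sphere_regular g ->
  sphere_regular (fun x => f x * g x).
Proof.
move=> [f' [mf [M hM] ff]] [g' [mg [N hN] gg]].
exists (fun x => f' x * g' x); split; first exact: measurable_funM.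
  by exists (M * N) => x; rewrite normrM ler_pM.
by move=> x Sx; rewrite ff // gg.
Qed.

Lemma regular_cst c : sphere_regular (fun=> c).
Proof. by exists (fun=> c); split => //; exists `|c|. Qed.

Lemma regular_eq f g : (forall x, sphere d x -> f x = g x) ->
  sphere_regular g -> sphere_regular f.
Proof.
move=> fg [g' [mg bg gg]]; exists g'; split => // x Sx.
by rewrite fg // gg.
Qed.

Lemma bounded_integrable g M : measurable_fun setT g -> (forall x, `|g x| <= M) ->
  P.-integrable setT (EFin \o g).
Proof.
move=> mg hM; apply: measurable_bounded_integrable => //.
  by rewrite (le_lt_trans (probability_le1 P measurableT)) // ltry.
exists M; split; first exact: num_real.
by move=> N MN x _ /=; rewrite (le_trans (hM x)) // ltW.
Qed.

Lemma IntD f g : sphere_regular f -> sphere_regular g ->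
  Int (fun x => f x + g x) = Int f + Int g.
Proof.
move=> [f' [mf [M hM] ff]] [g' [mg [N hN] gg]].
rewrite (Int_eq ff) (Int_eq gg) (@Int_eq _ (fun x => f' x + g' x)).
  by apply: RintegralD => //; [exact: bounded_integrable hM|exact: bounded_integrable hN].
by move=> x Sx; rewrite ff // gg.
Qed.

Lemma IntZ c f : sphere_regular f -> Int (fun x => c * f x) = c * Int f.
Proof.
move=> [f' [mf [M hM] ff]].
rewrite (Int_eq ff) (@Int_eq _ (fun x => c * f' x)).
  by apply: RintegralZl => //; exact: bounded_integrable hM.
by move=> x Sx; rewrite ff.
Qed.

Lemma Int_cst c : Int (fun=> c) = c.
Proof.
rewrite Rintegral_cst // (_ : fine _ = 1) ?mulr1 //.
exact: (congr1 fine (probability_setT P)).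
Qed.

Lemma Int_sum n (F : 'I_n -> d.-tuple R -> R) :
  (forall i, sphere_regular (F i)) ->
  Int (fun x => \sum_(i < n) F i x) = \sum_(i < n) Int (F i).
Proof.
elim: n F => [|n IH] F hF.
  by rewrite big_ord0 -[RHS](Int_cst 0); apply: Int_eq => x _; rewrite big_ord0.
have hS m (G : 'I_m -> d.-tuple R -> R) : (forall i, sphere_regular (G i)) ->
    sphere_regular (fun x => \sum_(i < m) G i x).
  elim: m G => [|m IHm] G hG.
    by apply: (regular_eq _ (regular_cst 0)) => x _; rewrite big_ord0.
  apply: (@regular_eq _ (fun x => G ord0 x + \sum_(i < m) G (lift ord0 i) x)).
    by move=> x _; rewrite big_ord_recl.
  by apply: regularD => //; exact: IHm.
rewrite big_ord_recl -IH // -IntD //; last exact: hS.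
by apply: Int_eq => x _; rewrite big_ord_recl.
Qed.

Lemma Int_norm_le f M : 0 <= M -> sphere_regular f ->
  (forall x, sphere d x -> `|f x| <= M) -> `|Int f| <= M.
Proof.
move=> M0 [f' [mf _ ff]] fM.
pose g x := f' x * \1_(sphere d) x.
have gE x : sphere d x -> f x = g x.
  by move=> Sx; rewrite /g indicE mem_set // mulr1 ff.
have mg : measurable_fun setT g.
  apply: measurable_funM => //.
  by apply: measurable_indic; exact: measurable_sphere.
have gM x : `|g x| <= M.
  have [Sx|Sx] := pselect (sphere d x); first by rewrite -gE // fM.
  by rewrite /g indicE memNset // mulr0 normr0.
rewrite (Int_eq gE).
have gi := bounded_integrable mg gM.
rewrite (le_trans (le_normr_Rintegral _ gi)) //.
rewrite -[leRHS]Int_cst; apply: le_Rintegral => //.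
  by apply: (@bounded_integrable _ M) => [|x]; [exact: measurableT_comp|rewrite normr_id].
by apply: (@bounded_integrable _ `|M|).
Qed.

End SphereIntegral.

(** * From invariance under rotations to its infinitesimal form *)

Section RotationInvariance.
Context {R : realType} {d : nat}.
Variable P : probability (d.-tuple R) R.
Hypothesis hP : uniform_sphere_measure P.
Implicit Types (x y : d.-tuple R) (p q : mpoly d R) (u : R).

Local Notation Int f := (Rintegral P setT f).
Local Notation ev p := (fun x : d.-tuple R => meval (tnth x) p).
Local Notation "c %:K" := (mpolyC d c) (at level 1, format "c %:K").
Local Notation "''x_' i" := (mpolyX R (mnm1 i)) (at level 8, i at level 2).
Local Notation "''d_' i" := (@mderiv d R i) (at level 8, i at level 2).

Section Plane.
Variables i j : 'I_d.
Hypothesis ij : i != j.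

(* Rational parametrization of the circle: angle 2 arctan u. *)
Definition rcos u : R := (1 - u ^+ 2) / (1 + u ^+ 2).
Definition rsin u : R := 2 * u / (1 + u ^+ 2).

Lemma rden_gt0 u : 0 < 1 + u ^+ 2.
Proof. by rewrite ltr_wpDr ?sqr_ge0. Qed.

Lemma rcos2Drsin2 u : rcos u * rcos u + rsin u * rsin u = 1.
Proof.
have := lt0r_neq0 (rden_gt0 u); rewrite /rcos /rsin expr2 => h.
by field.
Qed.

Lemma rcos_sub1 u : `|rcos u - 1| <= 2 * u ^+ 2.
Proof.
have h := rden_gt0 u.
have -> : rcos u - 1 = - (2 * u ^+ 2 / (1 + u ^+ 2)).
  by have := lt0r_neq0 h; rewrite /rcos expr2 => h'; field.
rewrite normrN ger0_norm; last by apply: divr_ge0; [apply: mulr_ge0 => //; exact: sqr_ge0|exact: ltW].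
by rewrite ler_pdivrMr //; move: (sqr_ge0 u); move: (u ^+ 2) => v v0; nra.
Qed.

Lemma rsin_sub u : `|u| <= 1 -> `|rsin u - 2 * u| <= 2 * u ^+ 2.
Proof.
move=> u1; have h := rden_gt0 u.
have -> : rsin u - 2 * u = - (u * (2 * u ^+ 2 / (1 + u ^+ 2))).
  by have := lt0r_neq0 h; rewrite /rsin expr2 => h'; field.
have r0 : 0 <= 2 * u ^+ 2 / (1 + u ^+ 2).
  by apply: divr_ge0; [apply: mulr_ge0 => //; exact: sqr_ge0|exact: ltW].
rewrite normrN normrM [`|_ / _|]ger0_norm //.
apply: (@le_trans _ _ (2 * u ^+ 2 / (1 + u ^+ 2))); first by rewrite ler_piMl.
by rewrite ler_pdivrMr //; move: (sqr_ge0 u); move: (u ^+ 2) => v v0; nra.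
Qed.

Definition rot u x : d.-tuple R := [tuple
  if k == i then rcos u * tnth x i - rsin u * tnth x j
  else if k == j then rsin u * tnth x i + rcos u * tnth x j
  else tnth x k | k < d].

Lemma dotp_rot u x y : dotp (rot u x) (rot u y) = dotp x y.
Proof.
have ji : j != i by rewrite eq_sym.
rewrite /dotp [LHS](bigD1 i) //= [RHS](bigD1 i) //=.
rewrite (bigD1 j) //= [in RHS](bigD1 j) //= !addrA.
congr (_ + _); last first.
  apply: eq_bigr => k /andP[/negbTE ki /negbTE kj].
  by rewrite !tnth_mktuple ki kj.
rewrite !tnth_mktuple !eqxx (negbTE ji).
rewrite -[tnth x i * tnth y i]mul1r -[tnth x j * tnth y j]mul1r.
rewrite -(rcos2Drsin2 u); ring.
Qed.

Lemma sphere_rot u x : sphere d x -> sphere d (rot u x).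
Proof. by rewrite /sphere /= dotp_rot. Qed.

Lemma measurable_rot u : measurable_fun setT (rot u).
Proof.
apply/measurable_fun_tnthP => k.
have mt (l : 'I_d) : measurable_fun setT (fun x : d.-tuple R => tnth x l).
  exact: measurable_tnth.
rewrite (_ : _ \o _ = fun x => if k == i then rcos u * tnth x i - rsin u * tnth x j
  else if k == j then rsin u * tnth x i + rcos u * tnth x j else tnth x k); last first.
  by apply/funext => x /=; rewrite tnth_mktuple.
case: (k == i); last case: (k == j) => //.
  by apply: measurable_funB; apply: measurable_funM => //; exact: measurable_cst.
by apply: measurable_funD; apply: measurable_funM => //; exact: measurable_cst.
Qed.

(** Cutting p off outside the sphere, which [rot u] preserves, gives a bounded integrand for the
    change of variables; the pushforward of P is P. *)
Lemma Int_rot u p : Int (fun x => meval (tnth (rot u x)) p) = Int (ev p).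
Proof.
have [M M0 hM] := ev_bounded p.
pose g x := meval (tnth x) p * \1_(sphere d) x.
have mg : measurable_fun setT g.
  apply: measurable_funM; first exact: measurable_ev.
  by apply: measurable_indic; exact: measurable_sphere.
have gM x : `|g x| <= M.
  have [Sx|Sx] := pselect (sphere d x).
    by rewrite /g indicE mem_set // mulr1 hM.
  by rewrite /g indicE memNset // mulr0 normr0.
rewrite (@Int_eq _ _ _ hP _ (g \o rot u)); last first.
  by move=> x Sx; rewrite /g /= indicE mem_set ?mulr1 //; exact: sphere_rot.
rewrite [RHS](@Int_eq _ _ _ hP _ g); last first.
  by move=> x Sx; rewrite /g /= indicE mem_set ?mulr1.
congr fine.
have mr := measurable_rot u.
have mgE : measurable_fun setT (EFin \o g) by exact/measurable_EFinP.
have := @integral_pushforward _ _ _ _ R (rot u) mr P setT (EFin \o g) mgE.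
rewrite preimage_setT => <- //; last first.
  apply: (@bounded_integrable _ _ _ (g \o rot u) M) => [|x]; last exact: gM.
  exact: measurableT_comp mg mr.
apply: eq_measure_integral => A mA _.
exact: (proj2 hP _ (dotp_rot u)).
Qed.

(** Half the derivative at u = 0 of p along [rot u], as the angle 2 arctan u has speed 2 there. *)
Definition rotgen p := 'x_i * 'd_j p - 'x_j * 'd_i p.

Lemma rotgenM p q : rotgen (p * q) = rotgen p * q + p * rotgen q.
Proof. by rewrite /rotgen !mderivM; ring. Qed.

(** Induction on the construction of p: coordinates reduce to the rational functions [rcos] and
    [rsin], and products work because [rotgen] is a derivation. *)
Lemma rot_first_order p : exists2 C, 0 <= C & forall u x, `|u| <= 1 ->
  sphere d x -> `|meval (tnth (rot u x)) p - meval (tnth x) p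
                  - 2 * u * meval (tnth x) (rotgen p)| <= C * u ^+ 2.
Proof.
elim/(@mpoly_alg_ind R d): p => [c|k|p q [C C0 hp] [D D0 hq]|p q [C C0 hp] [D D0 hq]].
- exists 0 => // u x _ _; rewrite /rotgen !mderivC !mulr0 subr0 meval0 !mevalC.
  by rewrite subrr mulr0 subr0 normr0 mul0r.
- exists 4 => // u x u1 Sx; rewrite !mevalXU tnth_mktuple /rotgen !mderivXU.
  rewrite mevalB !mevalM !mevalXU !(rmorph_nat (meval _)).
  have xi := sphere_coord_le1 i Sx; have xj := sphere_coord_le1 j Sx.
  have c1 := rcos_sub1 u; have s1 := rsin_sub u1.
  have bound a b : `|a| <= 2 * u ^+ 2 -> `|b| <= 2 * u ^+ 2 ->
      `|a * tnth x i + b * tnth x j| <= 4 * u ^+ 2.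
    move=> ha hb; rewrite (le_trans (ler_normD _ _)) // !normrM.
    rewrite (_ : 4 * u ^+ 2 = 2 * u ^+ 2 * 1 + 2 * u ^+ 2 * 1); last by ring.
    by rewrite lerD // ler_pM.
  have [->|ki] := eqVneq k i.
    rewrite (eq_sym j i) (negbTE ij) /=.
    rewrite (_ : _ - _ = (rcos u - 1) * tnth x i + - (rsin u - 2 * u) * tnth x j).
      by apply: bound => //; rewrite normrN.
    by ring.
  have [->|kj] := eqVneq k j.
    rewrite /=.
    rewrite (_ : _ - _ = (rsin u - 2 * u) * tnth x i + (rcos u - 1) * tnth x j).
      by apply: bound.
    by ring.
  rewrite /= !mulr0 !subrr mulr0 subr0 normr0.
  by rewrite mulr_ge0 ?sqr_ge0.
- exists (C + D) => [|u x u1 Sx]; first exact: addr_ge0.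
  have -> : rotgen (p + q) = rotgen p + rotgen q.
    by rewrite /rotgen !mderivD; ring.
  rewrite !(mevalD _ p q) (mevalD _ (rotgen p)) (mulrDl C D).
  apply: le_trans (lerD (hp u x u1 Sx) (hq u x u1 Sx)).
  apply: le_trans (ler_normD _ _); rewrite le_eqVlt; apply/orP; left.
  by apply/eqP; congr `|_|; ring.
have [Mp Mp0 hMp] := ev_bounded p.
have [Mq Mq0 hMq] := ev_bounded q.
have [Ma Ma0 hMa] := ev_bounded (rotgen p).
have [Mb Mb0 hMb] := ev_bounded (rotgen q).
exists (C * Mq + (Mp + 2 * Ma) * D + 4 * (Ma * Mb)) => [|u x u1 Sx].
  by rewrite !addr_ge0 ?mulr_ge0 ?addr_ge0 ?mulr_ge0.
rewrite rotgenM (mevalD _ (rotgen p * q)) !mevalM.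
have Srx := sphere_rot u Sx.
move: (hp u x u1 Sx) (hq u x u1 Sx) (hMp x Sx) (hMq _ Srx) (hMa x Sx) (hMb x Sx).
move: (meval _ p) (meval (tnth x) p) (meval _ q) (meval (tnth x) q)
  (meval _ (rotgen p)) (meval _ (rotgen q)) => P1 P0 Q1 Q0 A B hP1 hQ1 hP0 hQ hA hB.
(* The remainder of a product in terms of the remainders of its factors; Q1 is bounded because the
   rotated point stays on the sphere. *)
rewrite (_ : _ - _ = (P1 - P0 - 2 * u * A) * Q1 + (P0 + 2 * u * A) * (Q1 - Q0 - 2 * u * B)
   + 4 * (A * B) * u ^+ 2); last by ring.
rewrite [leRHS](_ : _ = C * Mq * u ^+ 2 + (Mp + 2 * Ma) * D * u ^+ 2
  + 4 * (Ma * Mb) * u ^+ 2); last by ring.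
rewrite (le_trans (ler_normD _ _)) // lerD //; last first.
  rewrite normrM [`|u ^+ 2|]ger0_norm ?sqr_ge0 // ler_wpM2r ?sqr_ge0 //.
  by rewrite !normrM ger0_norm // ler_wpM2l // ler_pM.
rewrite (le_trans (ler_normD _ _)) // lerD //.
  by rewrite normrM [leRHS]mulrAC ler_pM.
rewrite normrM -[leRHS]mulrA ler_pM // (le_trans (ler_normD _ _)) // lerD //.
by rewrite !normrM ger0_norm // -mulrA ler_wpM2l // -[leRHS]mul1r ler_pM.
Qed.

End Plane.

(** Integrating the first-order expansion, the two zeroth-order terms cancel by invariance, leaving
    2 u |e| <= C u^2 for all small u > 0. *)
Lemma Int_rotgen i j p : Int (ev (rotgen i j p)) = 0.
Proof.
have [->|ij] := eqVneq i j.
  rewrite -[RHS](Int_cst P 0); apply: (Int_eq hP) => x _.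
  by rewrite /rotgen subrr meval0.
have [C C0 hC] := rot_first_order ij p.
set e := Int _.
have bnd u : 0 < u -> u <= 1 -> 2 * `|e| <= C * u.
  move=> u0 u1.
  have reg : sphere_regular (fun x : d.-tuple R => meval (tnth (rot i j u x)) p).
    have [g [mg [M hM] gE]] := regular_ev p.
    exists (g \o rot i j u); split.
    - exact: measurableT_comp mg (measurable_rot i j u).
    - by exists M => x; exact: hM.
    - by move=> x Sx /=; rewrite gE //; exact: sphere_rot.
  have r1 := regular_ev p; have r2 := regular_ev (rotgen i j p).
  have : `|Int (fun x => meval (tnth (rot i j u x)) p + (-1) * meval (tnth x) p
            + (- (2 * u)) * meval (tnth x) (rotgen i j p))| <= C * u ^+ 2.
    apply: (Int_norm_le hP).
    - by rewrite mulr_ge0 ?sqr_ge0.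
    - by apply: regularD; [apply: regularD => //|]; apply: regularM => //; exact: regular_cst.
    - move=> x Sx; rewrite mulN1r mulNr.
      by apply: hC => //; rewrite ger0_norm ?(ltW u0).
  rewrite !(IntD hP) //; last 3 first.
  - by apply: regularM => //; exact: regular_cst.
  - by apply: regularD => //; apply: regularM => //; exact: regular_cst.
  - by apply: regularM => //; exact: regular_cst.
  rewrite !(IntZ hP) // Int_rot // mulN1r subrr add0r -/e.
  rewrite normrM normrN (@ger0_norm _ (2 * u)); last by rewrite mulr_ge0 // ltW.
  by rewrite expr2 mulrA (mulrAC 2 u) ler_pM2r.
apply/eqP; rewrite -normr_eq0 eq_le normr_ge0 andbT leNgt; apply/negP => e0.
(* At this u the bound would give 2 |e| <= C |e| / (C + 1) < 2 |e|. *)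
have := bnd (Num.min 1 (`|e| / (C + 1))).
have C1 : 0 < C + 1 by rewrite ltr_wpDl.
rewrite lt_min ltr01 divr_gt0 //= ge_min lexx /= => /(_ isT isT).
apply/negP; rewrite -ltNge.
apply: (@le_lt_trans _ _ (C * (`|e| / (C + 1)))).
  by rewrite ler_wpM2l // ge_min lexx orbT.
rewrite mulrA ltr_pdivrMr //; nra.
Qed.

End RotationInvariance.

(** * Spectrum of the integral operator *)

Lemma kernel_tail0 {R : realType} : kernel_tail 0 = 1 :> R.
Proof. by rewrite /kernel_tail big_ord0 subr0. Qed.

Lemma kernel_tail_ge0 {R : realType} n : 0 <= kernel_tail n :> R.
Proof. by have := @kernel_coef_sum_le R n n; rewrite big_geq. Qed.

(** The substitute for letting n go to infinity. The start n0 allows estimates valid only once a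
    given index is included. *)
Lemma le_of_kernel_tail {R : realType} (A X B : R) n0 :
  (forall n, (n0 <= n)%N -> A <= X + kernel_tail n * B) -> A <= X.
Proof.
move=> h; rewrite leNgt; apply/negP => XA.
have B1 : 0 < `|B| + 1 by rewrite ltr_wpDl.
have e0 : 0 < (A - X) / (`|B| + 1) by rewrite divr_gt0 // subr_gt0.
have [n1 hn1] := kernel_tail_cvg0 e0.
have := h _ (leq_maxl n0 n1); have := hn1 _ (leq_maxr n0 n1).
have := @kernel_tail_ge0 R (maxn n0 n1); move: (kernel_tail _) => r r0.
rewrite ltr_pdivlMr // => r1 r2.
have : r * B <= r * `|B| by rewrite ler_wpM2l // ler_norm.
by nra.
Qed.

Lemma eq_of_kernel_tail {R : realType} (A X B : R) :
  (forall n, `|A - X| <= kernel_tail n * B) -> A = X.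
Proof.
move=> h; apply/eqP; rewrite -subr_eq0 -normr_eq0 eq_le normr_ge0 andbT.
by apply: (@le_of_kernel_tail R _ 0 B 0) => n _; rewrite add0r.
Qed.

Lemma exists_pos_lower_bound {R : realType} (f : nat -> R) n :
  (forall k, 0 < f k) -> exists2 c, 0 < c & forall k, (k <= n)%N -> c <= f k.
Proof.
move=> f0; elim: n => [|n [c c0 hc]].
  by exists (f 0%N) => // k; rewrite leqn0 => /eqP ->.
exists (Num.min c (f n.+1)); first by rewrite lt_min c0 f0.
move=> k; rewrite leq_eqVlt => /orP[/eqP ->|kn]; first by rewrite ge_min lexx orbT.
by rewrite ge_min hc.
Qed.

(** * Legendre polynomials and powers of t *)

Section Legendre.
Context {R : realType} {d : nat}.
Hypothesis d_gt1 : (1 < d)%N.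
Implicit Types (t : R) (l n : nat).

Lemma legendrePSS l t : legendreP d l.+2 t =
  ((2 * l.+1 + d - 2)%N%:R * t * legendreP d l.+1 t - l.+1%:R * legendreP d l t)
  / (l.+1 + d - 2)%N%:R.
Proof. by []. Qed.

Lemma legendreP_rec l t : (2 * l + d)%:R * (t * legendreP d l.+1 t) =
  (l + d.-1)%:R * legendreP d l.+2 t + l.+1%:R * legendreP d l t.
Proof.
have nz : (l.+1 + d - 2)%:R != 0 :> R by rewrite pnatr_eq0; lia.
rewrite legendrePSS (_ : (l + d.-1 = l.+1 + d - 2)%N); last by lia.
rewrite [X in X + _]mulrC divfK // subrK mulrA; congr (_%:R * _ * _); lia.
Qed.

Lemma legendreP1 l : legendreP d l (1 : R) = 1.
Proof.
elim/zonal_ind: l => [//|//|l IH IH1].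
have := legendreP_rec l 1; rewrite IH IH1 !mulr1 => h.
have nz : (l + d.-1)%:R != 0 :> R by rewrite pnatr_eq0; lia.
apply: (mulfI nz); rewrite mulr1; apply: (addIr l.+1%:R); rewrite -h -natrD.
by congr _%:R; lia.
Qed.

(* Multiplication by t maps the span of [P_0 .. P_n] into that of [P_0 .. P_(n+1)]. *)
Lemma expr_legendre_span n : exists q : nat -> R, forall t,
  t ^+ n = \sum_(l < n.+1) q l * legendreP d l t.
Proof.
elim: n => [|n [q hq]].
  by exists (fun=> 1) => t; rewrite big_ord1 mul1r.
have mul_span l : exists r : nat -> R, forall t, t * legendreP d l t =
    \sum_(i < l.+2) r i * legendreP d i t.
  case: l => [|l].
    exists (fun i => (i == 1%N)%:R) => t.
    by rewrite big_ord_recr big_ord1 /= mul0r add0r mul1r mulr1.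
  exists (fun i => if i == l then l.+1%:R / (2 * l + d)%:R else
              if i == l.+2 then (l + d.-1)%:R / (2 * l + d)%:R else 0) => t.
  rewrite 3!big_ord_recr /= big1 => [|i _]; last first.
    by rewrite ltn_eqF ?mul0r // ?ltn_eqF ?mul0r //; have := ltn_ord i; lia.
  do ![case: eqP => ?; try by lia]; rewrite add0r.
  have nz : (2 * l + d)%:R != 0 :> R by rewrite pnatr_eq0; lia.
  apply: (mulfI nz); rewrite legendreP_rec mul0r addr0 mulrDr.
  by rewrite !mulf_divKM // addrC.
have [r hr] := choice mul_span.
(* The coefficients [r l] are meaningful only below l + 2; the test pads each expansion with zeros
   to the common length n + 2. *)
exists (fun i => \sum_(l < n.+1) (if (i < l.+2)%N then q l * r l i else 0)) => t.
rewrite exprS hq mulr_sumr.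
transitivity (\sum_(l < n.+1) \sum_(i < n.+2)
    (if (i < l.+2)%N then q l * r l i else 0) * legendreP d i t).
  apply: eq_bigr => l _; rewrite mulrCA hr mulr_sumr.
  rewrite (big_ord_widen n.+2 (fun i => q l * (r l i * legendreP d i t))).
    rewrite big_mkcond; apply: eq_bigr => i _.
    by case: ifP => _; rewrite ?mul0r // mulrA.
  by have := ltn_ord l; lia.
by rewrite exchange_big; apply: eq_bigr => i _; rewrite mulr_suml.
Qed.

End Legendre.

Section Spectrum.
Context {R : realType} {d : nat}.
Hypothesis d_gt1 : (1 < d)%N.
Variable P : probability (d.-tuple R) R.
Hypothesis hP : uniform_sphere_measure P.
Implicit Types (x y : d.-tuple R) (p q : mpoly d R) (Y : d.-tuple R -> R).

Local Notation Int f := (Rintegral P setT f).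
Local Notation ev p := (fun x : d.-tuple R => meval (tnth x) p).
Local Notation "c %:K" := (mpolyC d c) (at level 1, format "c %:K").
Local Notation E := (fun p : mpoly d R => Int (ev p)).

Let ED p q : E (p + q) = E p + E q.
Proof.
rewrite -(IntD hP); [|exact: regular_ev|exact: regular_ev].
by apply: (Int_eq hP) => x _; rewrite mevalD.
Qed.

Let EZ a p : E (a%:K * p) = a * E p.
Proof.
rewrite -(IntZ hP); last exact: regular_ev.
by apply: (Int_eq hP) => x _; rewrite mevalM mevalC.
Qed.

Let E_sphere p : E (sqnorm * p) = E p.
Proof.
apply: (Int_eq hP) => x Sx; rewrite mevalM meval_sqnorm.
by rewrite [X in X * _]Sx mul1r.
Qed.

Let E1 : E 1 = 1.
Proof. by rewrite -[RHS](Int_cst P 1); apply: (Int_eq hP) => x _; rewrite meval1. Qed.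

Let E_rot i j p :
  E (mpolyX R (mnm1 i) * mderiv j p - mpolyX R (mnm1 j) * mderiv i p) = 0.
Proof. exact: Int_rotgen. Qed.

(** Expand |x + s y|^2 >= 0 for s = 1 and s = -1. *)
Lemma dotp_norm_le1 x y : sphere d x -> sphere d y -> -1 <= dotp x y <= 1.
Proof.
move=> Sx Sy.
have h (s : R) : s * s = 1 -> 0 <= 2 + 2 * s * dotp x y.
  move=> s1; have : 0 <= \sum_(i < d) (tnth x i + s * tnth y i) ^+ 2.
    by apply: sumr_ge0 => i _; exact: sqr_ge0.
  rewrite (_ : \sum_(i < d) _ = dotp x x + s * s * dotp y y + 2 * s * dotp x y).
    by rewrite Sx Sy s1; lra.
  rewrite /dotp !mulr_sumr -!big_split; apply: eq_bigr => i _ /=; ring.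
have := h 1 (mulr1 _); have := h (-1); rewrite mulrNN mulr1 => /(_ (mulr1 _)).
lra.
Qed.

Lemma sphere_inhabited : exists x : d.-tuple R, sphere d x.
Proof.
exists [tuple (k == Ordinal (ltnW d_gt1))%:R | k < d].
rewrite /sphere /= /dotp (bigD1 (Ordinal (ltnW d_gt1))) //= big1 => [|i h].
  by rewrite tnth_mktuple eqxx mulr1 addr0.
by rewrite tnth_mktuple (negbTE h) mul0r.
Qed.

Lemma sph_harmP l Y : sph_harm l Y <-> exists q, harmonic l q /\
  forall x, sphere d x -> Y x = meval (tnth x) q.
Proof.
by split => -[q [[hq Lq] hY]]; exists q; split => //; split => //; apply/homogP.
Qed.

Lemma meval_zonal_dotp l x y : sphere d y ->
  meval (tnth y) (zonal (tnth x) l) = legendreP d l (dotp x y).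
Proof. by move=> Sy; rewrite meval_zonal. Qed.

Lemma sph_harm_legendre l x : sphere d x ->
  sph_harm l (fun y => legendreP d l (dotp x y)).
Proof.
move=> Sx; apply/sph_harmP; exists (zonal (tnth x) l); split.
  exact: harmonic_zonal.
by move=> y Sy; rewrite meval_zonal_dotp.
Qed.

Lemma meval_linform_dotp x y : meval (tnth y) (linform (tnth x)) = dotp x y.
Proof. by rewrite meval_linform. Qed.

Lemma funk_hecke_dotp n l q x : sphere d x -> harmonic l q ->
  Int (fun y => dotp x y ^+ n * meval (tnth y) q) = lam d n l * meval (tnth x) q.
Proof.
move=> Sx hq; rewrite -(funk_hecke_monomial d_gt1 ED EZ E_sphere E1 E_rot n Sx hq).
by apply: (Int_eq hP) => y _; rewrite mevalM rmorphXn /= meval_linform_dotp.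
Qed.

Lemma kernelE x y : Kker x y = kernel (dotp x y).
Proof. by rewrite /Kker /K1 /K0 /kernel; ring. Qed.

Lemma kernel_psum_ev n x y : \sum_(i < n) kernel_coef i * dotp x y ^+ i =
  meval (tnth y) (\sum_(i < n) (kernel_coef i)%:K * linform (tnth x) ^+ i).
Proof.
rewrite raddf_sum; apply: eq_bigr => i _ /=.
by rewrite mevalM mevalC rmorphXn /= meval_linform_dotp.
Qed.

(** Measurability comes from the power series, as a pointwise limit of cut-off polynomials; the
    bound 1 is [kernel_series_bound] at n = 0. *)
Lemma regular_kernel x : sphere d x -> sphere_regular (fun y => kernel (dotp x y)).
Proof.
move=> Sx; apply: (@sphere_regularP _ _ _ 1); last first.
  move=> y Sy; have := kernel_series_bound 0 (dotp_norm_le1 Sx Sy).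
  by rewrite big_ord0 subr0 kernel_tail0.
apply: (@measurable_fun_cvg _ _ _ setT (fun n y =>
    (\sum_(i < n) kernel_coef i * dotp x y ^+ i) * \1_(sphere d) y)).
  move=> n; apply: measurable_funM; last first.
    by apply: measurable_indic; exact: measurable_sphere.
  under eq_fun do rewrite kernel_psum_ev.
  exact: measurable_ev.
move=> y _; have [Sy|Sy] := pselect (sphere d y); last first.
  rewrite indicE memNset // mulr0; under eq_fun do rewrite mulr0.
  exact: cvg_cst.
rewrite indicE mem_set // mulr1; under eq_fun do rewrite mulr1.
apply/cvgrPdist_lt => e e0; have [n0 hn0] := kernel_tail_cvg0 e0.
exists n0 => //= n n0n; apply: le_lt_trans (hn0 n n0n).
exact: kernel_series_bound (dotp_norm_le1 Sx Sy).
Qed.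

(** Replacing the kernel by its partial sum costs at most the tail times a bound B of Y on the
    sphere; on the partial sum Funk-Hecke acts term by term. *)
Lemma TK_approx l Y x : sph_harm l Y -> sphere d x -> exists2 B, 0 <= B &
  forall n, `|TK P Y x - (\sum_(i < n) kernel_coef i * lam d i l) * Y x|
            <= kernel_tail n * B.
Proof.
move=> /sph_harmP[q [hq hY]] Sx; have [B B0 hB] := ev_bounded q.
exists B => // n.
have reg1 i : sphere_regular (fun y => dotp x y ^+ i * meval (tnth y) q).
  apply: (@regular_eq _ _ _ (ev (linform (tnth x) ^+ i * q))); last exact: regular_ev.
  by move=> y _; rewrite mevalM rmorphXn /= meval_linform_dotp.
have reg2 : sphere_regular (fun y => kernel (dotp x y) * meval (tnth y) q).
  by apply: regularM; [exact: regular_kernel|exact: regular_ev].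
have regs : sphere_regular (fun y => \sum_(i < n) kernel_coef i * dotp x y ^+ i).
  apply: (regular_eq (fun y _ => kernel_psum_ev n x y)); exact: regular_ev.
have -> : TK P Y x = Int (fun y => kernel (dotp x y) * meval (tnth y) q).
  by apply: (Int_eq hP) => y Sy; rewrite kernelE hY.
have -> : (\sum_(i < n) kernel_coef i * lam d i l) * Y x =
    Int (fun y => (\sum_(i < n) kernel_coef i * dotp x y ^+ i) * meval (tnth y) q).
  rewrite hY // mulr_suml.
  rewrite (@Int_eq _ _ _ hP _ (fun y => \sum_(i < n)
    kernel_coef i * (dotp x y ^+ i * meval (tnth y) q))); last first.
    by move=> y _; rewrite mulr_suml; apply: eq_bigr => i _; rewrite mulrA.
  rewrite (Int_sum hP) => [|i]; last first.
    by apply: regularM => //; exact: regular_cst.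
  by apply: eq_bigr => i _; rewrite (IntZ hP) // (funk_hecke_dotp i Sx hq) mulrA.
rewrite -mulN1r -(IntZ hP) -?(IntD hP) //.
- apply: (Int_norm_le hP); first by rewrite mulr_ge0 // kernel_tail_ge0.
    apply: regularD => //; apply: regularM; first exact: regular_cst.
    by apply: regularM => //; exact: regular_ev.
  move=> y Sy; rewrite mulN1r -mulrBl normrM ler_pM ?hB //.
  exact: kernel_series_bound (dotp_norm_le1 Sx Sy).
- apply: regularM; first exact: regular_cst.
  by apply: regularM => //; exact: regular_ev.
- by apply: regularM => //; exact: regular_ev.
Qed.

(** [mu_eig] is a choice with default 0, so an eigenvalue must be exhibited and shown unique. The
    zonal function Z, with Z(x0) = 1, does both: the candidate is T_K Z(x0), and any eigenvalue must
    equal it. *)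
Lemma mu_eigP l : is_eig_on_H P l (mu_eig P l) /\ exists2 B, 0 <= B &
  forall n, `|mu_eig P l - \sum_(i < n) kernel_coef i * lam d i l|
            <= kernel_tail n * B.
Proof.
have [x0 Sx0] := sphere_inhabited.
pose Z := fun y => legendreP d l (dotp x0 y).
have hZ : sph_harm l Z by exact: sph_harm_legendre.
have Z1 : Z x0 = 1 by rewrite /Z Sx0 legendreP1.
pose m := TK P Z x0.
have [B B0 hB] := TK_approx hZ Sx0.
have hB' n : `|m - \sum_(i < n) kernel_coef i * lam d i l| <= kernel_tail n * B.
  by have := hB n; rewrite Z1 mulr1.
have m_eig : is_eig_on_H P l m.
  move=> Y hY x Sx; have [D D0 hD] := TK_approx hY Sx.
  apply: (@eq_of_kernel_tail _ _ _ (D + B * `|Y x|)) => n.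
  pose s : R := \sum_(i < n) kernel_coef i * lam d i l.
  rewrite (_ : _ - _ = (TK P Y x - s * Y x) + - ((m - s) * Y x)); last by ring.
  rewrite (le_trans (ler_normD _ _)) // mulrDr lerD ?hD //.
  by rewrite normrN normrM mulrA; apply: ler_wpM2r => //; exact: hB'.
have mu_is_eig : is_eig_on_H P l (mu_eig P l).
  by rewrite /mu_eig; apply: (@xgetPex _ 0 [set m | is_eig_on_H P l m]); exists m.
have -> : mu_eig P l = m.
  by have := mu_is_eig Z hZ x0 Sx0; rewrite Z1 mulr1.
by split => //; exists B.
Qed.

Lemma mu_eig_approx l : exists B, 0 <= B /\
  forall n, `|mu_eig P l - \sum_(i < n) kernel_coef i * lam d i l|
            <= kernel_tail n * B.
Proof. by have [_ [B]] := mu_eigP l; exists B. Qed.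

Lemma mu_eig_lb l : kernel_coef l * lam_diag d l <= mu_eig P l.
Proof.
have [_ [B B0 hB]] := mu_eigP l.
apply: (@le_of_kernel_tail _ _ _ B l.+1) => n ln.
have := hB n; rewrite ler_norml => /andP[h _].
have : kernel_coef l * lam_diag d l <= \sum_(i < n) kernel_coef i * lam d i l :> R.
  rewrite (bigD1 (Ordinal ln)) //= lamnn lerDl; apply: sumr_ge0 => i _.
  by rewrite mulr_ge0 ?lam_ge0 // ltW // kernel_coef_gt0.
lra.
Qed.

Lemma mu_eig_ge0 l : 0 <= mu_eig P l.
Proof.
apply: le_trans (mu_eig_lb l).
by rewrite mulr_ge0 ?lam_diag_ge0 // ltW // kernel_coef_gt0.
Qed.

Lemma mu_eig_ub l : (l * l + 2 <= d)%N -> mu_eig P l <= lam_diag d l.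
Proof.
move=> ld; have [_ [B B0 hB]] := mu_eigP l.
apply: (@le_of_kernel_tail _ _ _ B 0) => n _.
have := hB n; rewrite ler_norml => /andP[_ h].
have : \sum_(i < n) kernel_coef i * lam d i l <= lam_diag d l :> R; last by lra.
apply: (@le_trans _ _ ((\sum_(i < n) kernel_coef i) * lam_diag d l)).
  rewrite mulr_suml; apply: ler_sum => i _.
  by rewrite ler_wpM2l ?lam_le_diag // ltW // kernel_coef_gt0.
rewrite ler_piMl ?lam_diag_ge0 //.
by have := @kernel_coef_sum_le R 0 n; rewrite kernel_tail0 big_mkord.
Qed.

(** * Addition theorem and Legendre series of the kernel *)

Section OrthonormalBasis.
Unset Implicit Arguments.
Variable Y : forall l : nat, 'I_(Ndim d l) -> d.-tuple R -> R.
Set Implicit Arguments.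
Hypothesis Y_harm : forall l j, sph_harm l (Y l j).
Hypothesis Y_orth : forall l (i j : 'I_(Ndim d l)),
  Int (fun x => Y l i x * Y l j x) = (i == j)%:R.
Hypothesis Y_span : forall l (f : d.-tuple R -> R), sph_harm l f ->
  exists a : 'I_(Ndim d l) -> R,
    forall x, sphere d x -> f x = \sum_(j < Ndim d l) a j * Y l j x.

Lemma regular_Y l j : sphere_regular (Y l j).
Proof.
have /sph_harmP[q [_ hq]] := Y_harm j.
exact: regular_eq hq (regular_ev q).
Qed.

(* Zonal harmonics reproduce [H_l] up to a constant; integrating the addition
   formula over the diagonal identifies the constant as [1 / Ndim d l]. *)
Lemma addition_theorem l : exists c : R, [/\ c * (Ndim d l)%:R = 1,
  forall x y, sphere d x -> sphere d y ->
    legendreP d l (dotp x y) = c * \sum_(j < Ndim d l) Y l j x * Y l j y &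
  forall x q, sphere d x -> harmonic l q ->
    E (zonal (tnth x) l * q) = c * meval (tnth x) q].
Proof.
have [c hc] := zonal_reproducing d_gt1 ED EZ E_sphere E1 E_rot l.
have hadd x y : sphere d x -> sphere d y ->
    legendreP d l (dotp x y) = c * \sum_(j < Ndim d l) Y l j x * Y l j y.
  move=> Sx Sy; have [a ha] := Y_span (sph_harm_legendre l Sx).
  rewrite ha // mulr_sumr; apply: eq_bigr => j _; rewrite mulrA; congr (_ * _).
  have /sph_harmP[q [hq hqE]] := Y_harm j.
  rewrite hqE // -hc //.
  transitivity (Int (fun z => \sum_(k < Ndim d l) a k * (Y l k z * Y l j z))).
    rewrite (Int_sum hP) => [|k]; last first.
      by apply: regularM; [exact: regular_cst|apply: regularM; exact: regular_Y].
    rewrite (bigD1 j) //= big1 => [|k kj]; rewrite (IntZ hP) ?Y_orth.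
    - by rewrite eqxx mulr1 addr0.
    - by apply: regularM; exact: regular_Y.
    - by rewrite (negbTE kj) mulr0.
    - by apply: regularM; exact: regular_Y.
  apply: (Int_eq hP) => z Sz; rewrite mevalM meval_zonal_dotp // -hqE // ha //.
  by rewrite mulr_suml; apply: eq_bigr => k _; rewrite mulrA.
exists c; split => //; last by move=> x q Sx hq; exact: hc.
rewrite -[RHS](Int_cst P 1).
transitivity (Int (fun x => \sum_(j < Ndim d l) c * (Y l j x * Y l j x))).
  rewrite (Int_sum hP) => [|k]; last first.
    by apply: regularM; [exact: regular_cst|apply: regularM; exact: regular_Y].
  under eq_bigr => j _.
    rewrite (IntZ hP) ?Y_orth ?eqxx; last by apply: regularM; exact: regular_Y.
    over.
  by rewrite /= mulr1 sumr_const card_ord mulr_natr.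
by apply: (Int_eq hP) => x Sx; rewrite -mulr_sumr -hadd // Sx legendreP1.
Qed.

Lemma addition_formula l x y : sphere d x -> sphere d y ->
  \sum_(j < Ndim d l) Y l j x * Y l j y = (Ndim d l)%:R * legendreP d l (dotp x y).
Proof.
move=> Sx Sy; have [c [cN hadd _]] := addition_theorem l.
by rewrite hadd // mulrA (mulrC _%:R) cN mul1r.
Qed.

(** Termwise |u v| <= (u^2 + v^2) / 2 in the addition theorem; on the diagonal it gives P_l(1) = 1
    for both x and y. *)
Lemma legendreP_le1 l x y : sphere d x -> sphere d y ->
  `|legendreP d l (dotp x y)| <= 1.
Proof.
move=> Sx Sy; have [c [cN hadd _]] := addition_theorem l.
have c0 : 0 <= c.
  rewrite leNgt; apply/negP => c0.
  have : c * (Ndim d l)%:R <= 0 by rewrite mulr_le0_ge0 // ltW.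
  by rewrite cN leNgt ltr01.
have hx : c * \sum_(j < Ndim d l) Y l j x * Y l j x = 1.
  by rewrite -hadd // Sx legendreP1.
have hy : c * \sum_(j < Ndim d l) Y l j y * Y l j y = 1.
  by rewrite -hadd // Sy legendreP1.
rewrite hadd // normrM (ger0_norm c0).
apply: (@le_trans _ _ (c * \sum_(j < Ndim d l)
    (Y l j x * Y l j x / 2 + Y l j y * Y l j y / 2))).
  rewrite ler_wpM2l // (le_trans (ler_norm_sum _ _ _)) //.
  apply: ler_sum => j _; rewrite ler_norml.
  have := sqr_ge0 (Y l j x - Y l j y); have := sqr_ge0 (Y l j x + Y l j y).
  rewrite !expr2; move: (Y l j x) (Y l j y) => u v; nra.
by rewrite big_split /= -!mulr_suml mulrDr !mulrA hx hy; lra.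
Qed.

(** Some expansion exists by [expr_legendre_span]. Testing it against Z_m at x identifies its
    coefficients: Funk-Hecke gives [lam d n m], orthogonality and reproduction give q_m c with c
    N(d,m) = 1. *)
Lemma expr_legendre n x y : sphere d x -> sphere d y -> dotp x y ^+ n =
  \sum_(l < n.+1) (Ndim d l)%:R * lam d n l * legendreP d l (dotp x y).
Proof.
move=> Sx Sy; have [q hq] := @expr_legendre_span R d d_gt1 n.
rewrite hq; apply: eq_bigr => m _; congr (_ * _).
have [c [cN _ hc]] := addition_theorem m.
have hZ l := harmonic_zonal d_gt1 Sx l.
suff : lam d n m = q m * c by move=> ->; rewrite mulrC -mulrA cN mulr1.
have := @funk_hecke_dotp n _ _ _ Sx (hZ m).
rewrite meval_zonal_dotp // Sx legendreP1 // mulr1 => <-.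
transitivity (Int (fun z => \sum_(l < n.+1)
    q l * meval (tnth z) (zonal (tnth x) l * zonal (tnth x) m))).
  apply: (Int_eq hP) => z Sz; rewrite hq mulr_suml; apply: eq_bigr => l _.
  by rewrite mevalM !meval_zonal_dotp // mulrA.
rewrite (Int_sum hP) => [|l]; last first.
  by apply: regularM; [exact: regular_cst|exact: regular_ev].
rewrite (bigD1 m) //= big1 => [|l lm]; rewrite (IntZ hP); try exact: regular_ev.
  by rewrite hc // meval_zonal_dotp // Sx legendreP1 // mulr1 addr0.
rewrite (mean_harmonic_orth d_gt1 ED EZ E_sphere E_rot _ (hZ l) (hZ m)) ?mulr0 //.
Qed.

Lemma sum_Ndim_lam n : \sum_(l < n.+1) (Ndim d l)%:R * lam d n l = 1 :> R.
Proof.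
have [x Sx] := sphere_inhabited; have := expr_legendre n Sx Sx.
rewrite Sx expr1n => e1; rewrite [RHS]e1; apply: eq_bigr => l _.
by rewrite legendreP1 // mulr1.
Qed.

Lemma Ndim_lam_ge0 i l : 0 <= (Ndim d l)%:R * lam d i l :> R.
Proof. by rewrite mulr_ge0 // lam_ge0. Qed.

(** The bound is an indicator: for m > i all terms vanish by [lam_lt], otherwise they are part of
    weights summing to 1. *)
Lemma sum_Ndim_lam_le m n i :
  \sum_(m <= l < n) (Ndim d l)%:R * lam d i l <= (m <= i)%N%:R :> R.
Proof.
case: (leqP m i) => mi /=; last first.
  rewrite big_nat big1 // => l /andP[ml _].
  by rewrite lam_lt ?mulr0 // (leq_trans mi).
rewrite -[leRHS](sum_Ndim_lam i) -(big_mkord xpredT (fun l => (Ndim d l)%:R * lam d i l)).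
apply: (@le_trans _ _ (\sum_(0 <= l < maxn n i.+1) (Ndim d l)%:R * lam d i l)).
  have [mn|nm] := leqP m n; last first.
    by rewrite big_geq ?(ltnW nm) // sumr_ge0 // => l _; exact: Ndim_lam_ge0.
  rewrite [leRHS](big_cat_nat (leq0n m)) /=; last by rewrite leq_max mn.
  rewrite [X in _ <= _ + X](big_cat_nat mn) ?leq_maxl //=.
  rewrite addrCA lerDl addr_ge0 // sumr_ge0 // => l _; exact: Ndim_lam_ge0.
rewrite [leLHS](big_cat_nat (leq0n i.+1)) ?leq_maxr //= gerDl.
rewrite big_nat big1 // => l /andP[il _].
by rewrite lam_lt ?mulr0.
Qed.

(** Exchanging the sums over l and i leaves the indicator m <= i, so only the coefficients from m on
    contribute. *)
Lemma mu_series_abs m n :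
  \sum_(m <= l < n) mu_eig P l * (Ndim d l)%:R <= kernel_tail m :> R.
Proof.
have [B hB] := choice mu_eig_approx.
apply: (@le_of_kernel_tail _ _ _ (\sum_(m <= l < n) B l * (Ndim d l)%:R) 0) => M _.
apply: (@le_trans _ _ (\sum_(m <= l < n)
    (\sum_(i < M) kernel_coef i * lam d i l + kernel_tail M * B l) * (Ndim d l)%:R)).
  apply: ler_sum => l _; rewrite ler_wpM2r //.
  by have [_ /(_ M)] := hB l; rewrite ler_norml => /andP[_]; lra.
under eq_bigr do rewrite mulrDl -mulrA.
rewrite big_split /= -mulr_sumr lerD2r.
under eq_bigr do rewrite mulr_suml.
rewrite exchange_big /=.
apply: (@le_trans _ _ (\sum_(i < M) kernel_coef i * (m <= i)%N%:R)).
  apply: ler_sum => i _; rewrite [leLHS](_ : _ = kernel_coef i *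
      \sum_(m <= l < n) (Ndim d l)%:R * lam d i l).
    by rewrite ler_wpM2l ?sum_Ndim_lam_le // ltW // kernel_coef_gt0.
  by rewrite mulr_sumr; apply: eq_bigr => l _; ring.
rewrite (le_trans _ (kernel_coef_sum_le m M)) //.
rewrite -(big_mkord xpredT (fun i => kernel_coef i * (m <= i)%N%:R)).
have [mM|Mm] := leqP m M.
  rewrite (big_cat_nat (leq0n m) mM) //= big_nat big1 => [|i /andP[_ im]].
    rewrite add0r big_nat [leRHS]big_nat le_eqVlt; apply/orP; left; apply/eqP.
    by apply: eq_bigr => i /andP[mi _]; rewrite mi mulr1.
  by rewrite leqNgt im mulr0.
rewrite [leRHS]big_geq ?(ltnW Mm) // big_nat big1 // => i /andP[_ iM].
by rewrite leqNgt (ltn_trans iM Mm) mulr0.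
Qed.

(** Truncate the power series at M >= n. For i < n the first n Legendre terms give t^i exactly; for
    i >= n the missing terms have total weight at most 1. What remains is a multiple of
    [kernel_tail M]. *)
Lemma mu_series n x y : sphere d x -> sphere d y ->
  `|\sum_(l < n) mu_eig P l * (Ndim d l)%:R * legendreP d l (dotp x y) - Kker x y|
  <= kernel_tail n.
Proof.
move=> Sx Sy; rewrite kernelE; set t := dotp x y.
have [B hB] := choice mu_eig_approx.
apply: (@le_of_kernel_tail _ _ _ (\sum_(l < n) B l * (Ndim d l)%:R + 1) n) => M nM.
pose s l : R := \sum_(i < M) kernel_coef i * lam d i l.
pose S1 := \sum_(l < n) s l * (Ndim d l)%:R * legendreP d l t.
pose S2 := \sum_(i < M) kernel_coef i * t ^+ i.
set S0 := \sum_(l < n) _.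
rewrite (_ : S0 - kernel t = (S1 - S2) + ((S0 - S1) + (S2 - kernel t))); last by ring.
rewrite (le_trans (ler_normD _ _)) // lerD //; last first.
  rewrite (le_trans (ler_normD _ _)) // mulrDr mulr1 lerD //; last first.
    by rewrite distrC; exact: kernel_series_bound (dotp_norm_le1 Sx Sy).
  rewrite /S0 /S1 -sumrB (le_trans (ler_norm_sum _ _ _)) // mulr_sumr.
  apply: ler_sum => l _; rewrite -!mulrBl !normrM mulrA.
  rewrite -[leRHS]mulr1 ler_pM ?mulr_ge0 //; last exact: legendreP_le1.
  by rewrite normr_nat ler_wpM2r //; have [_] := hB l; apply.
have -> : S1 - S2 = \sum_(i < M) kernel_coef i *
    ((\sum_(l < n) (Ndim d l)%:R * lam d i l * legendreP d l t) - t ^+ i).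
  rewrite /S1 /S2 /s; under eq_bigr do rewrite !mulr_suml.
  rewrite exchange_big /= -sumrB; apply: eq_bigr => i _.
  by rewrite mulrBr mulr_sumr; congr (_ - _); apply: eq_bigr => l _; ring.
rewrite (le_trans (ler_norm_sum _ _ _)) //.
rewrite (le_trans _ (kernel_coef_sum_le n M)) //.
pose F i := `|kernel_coef i *
    (\sum_(l < n) (Ndim d l)%:R * lam d i l * legendreP d l t - t ^+ i)|.
rewrite -(big_mkord xpredT F) (big_cat_nat (leq0n n) nM) //= big_nat big1 => [|i /andP[_ i_n]].
  rewrite add0r big_nat [leRHS]big_nat; apply: ler_sum => i /andP[ni _].
  rewrite /F normrM gtr0_norm ?kernel_coef_gt0 // ler_piMr ?(ltW (kernel_coef_gt0 _)) //.
  pose G l := (Ndim d l)%:R * lam d i l * legendreP d l t.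
  rewrite distrC expr_legendre // -/t.
  rewrite -!(big_mkord xpredT G) (big_cat_nat (leq0n n) (leqW ni)) /= addrAC subrr add0r.
  rewrite (le_trans (ler_norm_sum _ _ _)) //.
  apply: (@le_trans _ _ (\sum_(n <= l < i.+1) (Ndim d l)%:R * lam d i l)).
    apply: ler_sum => l _; rewrite /G normrM (ger0_norm (Ndim_lam_ge0 _ _)).
    by rewrite ler_piMr ?Ndim_lam_ge0 // legendreP_le1.
  by rewrite (le_trans (sum_Ndim_lam_le _ _ _)) //; case: (n <= i)%N.
rewrite /F (_ : _ - _ = 0) ?mulr0 ?normr0 //.
pose G l := (Ndim d l)%:R * lam d i l * legendreP d l t.
rewrite expr_legendre // -/t -!(big_mkord xpredT G) (big_cat_nat (leq0n i.+1) i_n) /=.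
rewrite addrAC subrr add0r big_nat big1 // => l /andP[il _].
by rewrite /G lam_lt // mulr0 mul0r.
Qed.

End OrthonormalBasis.
End Spectrum.

Theorem mainTheorem15 (R : realType) (kbar : nat) :
  (exists (d0 : nat) (c C : R), (0 < d0)%N /\ 0 < c /\ 0 < C /\
    forall d : nat, (d0 <= d)%N ->
    forall P : probability (d.-tuple R) R, uniform_sphere_measure P ->
    forall k : nat, (k <= kbar)%N ->
      c * (d%:R ^- k) <= mu_eig P k /\ mu_eig P k <= C * (d%:R ^- k))
  /\
  (forall d : nat, (2 <= d)%N ->
   forall P : probability (d.-tuple R) R, uniform_sphere_measure P ->
   (* T_K acts on H_l as multiplication by mu_l *)
   (forall (l : nat) (Y : d.-tuple R -> R), sph_harm l Y ->
      forall x, sphere d x -> TK P Y x = mu_eig P l * Y x) /\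
   (* expansion, for every choice of L^2(mu)-orthonormal bases of the H_l *)
   forall Y : forall l : nat, 'I_(Ndim d l) -> d.-tuple R -> R,
     (forall l j, sph_harm l (Y l j)) ->
     (forall l (i j : 'I_(Ndim d l)),
        Rintegral P setT (fun x => Y l i x * Y l j x) = (i == j)%:R) ->
     (forall l (f : d.-tuple R -> R), sph_harm l f ->
        exists a : 'I_(Ndim d l) -> R,
          forall x, sphere d x -> f x = \sum_(j < Ndim d l) a j * Y l j x) ->
     let term1 := fun l x x' =>
       mu_eig P l * \sum_(j < Ndim d l) Y l j x * Y l j x' in
     let term2 := fun l (x x' : d.-tuple R) =>
       mu_eig P l * (Ndim d l)%:R * legendreP d l (dotp x x') in
     (* the eigenfunctions satisfy T_K Y_lj = mu_l Y_lj *)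
     (forall l j x, sphere d x -> TK P (Y l j) x = mu_eig P l * Y l j x) /\
     (* both series converge uniformly on S^{d-1} x S^{d-1} to K *)
     (forall e : R, 0 < e -> exists n0 : nat, forall n : nat, (n0 <= n)%N ->
        forall x x', sphere d x -> sphere d x' ->
          `|\sum_(l < n) term1 l x x' - Kker x x'| < e /\
          `|\sum_(l < n) term2 l x x' - Kker x x'| < e) /\
     (* and absolutely: the series of absolute values is uniformly Cauchy *)
     (forall e : R, 0 < e -> exists n0 : nat, forall m n : nat,
        (n0 <= m)%N -> (m <= n)%N ->
        forall x x', sphere d x -> sphere d x' ->
          \sum_(m <= l < n) `|term1 l x x'| < e /\
          \sum_(m <= l < n) `|term2 l x x'| < e)).
Proof.
split.
  have f0 k : 0 < kernel_coef k * (2 * k + 1)%:R ^- k :> R.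
    by rewrite mulr_gt0 ?kernel_coef_gt0 // invr_gt0 exprn_gt0 // ltr0n addn1.
  have [c c0 hc] := exists_pos_lower_bound kbar f0.
  (* This d0 meets the condition of [mu_eig_ub] for all k <= kbar; c is a common lower bound of the
     constants a_k (2k+1)^(-k), and kbar! bounds every k!. *)
  exists (kbar * kbar + 2)%N, c, kbar`!%:R; split; first by rewrite addn2.
  split => //; split; first by rewrite ltr0n fact_gt0.
  move=> d hd P hP k hk.
  have d1 : (1 < d)%N by lia.
  have kd : (k * k + 2 <= d)%N by rewrite (leq_trans _ hd) // leq_add2r leq_mul.
  have dV : 0 <= d%:R ^- k :> R by rewrite invr_ge0 exprn_ge0.
  split.
    apply: le_trans (mu_eig_lb d1 hP k).
    apply: (@le_trans _ _ (kernel_coef k * (2 * k + 1)%:R ^- k * d%:R ^- k)).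
      by rewrite ler_wpM2r // hc.
    rewrite -mulrA ler_wpM2l ?(ltW (kernel_coef_gt0 _)) // lam_diag_lb //.
    exact: ltnW.
  apply: (le_trans (mu_eig_ub d1 hP kd)).
  rewrite (le_trans (lam_diag_ub _ (ltnW d1))) // ler_wpM2r // ler_nat.
  exact: leq_fact.
move=> d d1 P hP.
have eig l Y : sph_harm l Y -> forall x, sphere d x -> TK P Y x = mu_eig P l * Y x.
  by have [h _] := mu_eigP d1 hP l; exact: h.
split => // Y Y_harm Y_orth Y_span term1 term2.
(* By the addition formula both series agree term by term on the sphere, so each estimate is made
   once, on the Legendre form. *)
have term12 l x y : sphere d x -> sphere d y -> term1 l x y = term2 l x y.
  move=> Sx Sy; rewrite /term1 /term2 -mulrA.
  by rewrite (addition_formula d1 hP Y_harm Y_orth Y_span).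
split; first by move=> l j x Sx; exact: eig.
split=> e e0; have [n0 hn0] := kernel_tail_cvg0 e0; exists n0.
  move=> n n0n x y Sx Sy.
  have h : `|\sum_(l < n) term2 l x y - Kker x y| < e.
    apply: le_lt_trans (hn0 n n0n).
    exact: (mu_series d1 hP Y_harm Y_orth Y_span).
  by split => //; under eq_bigr do rewrite term12 //.
move=> m n n0m mn x y Sx Sy.
have h : \sum_(m <= l < n) `|term2 l x y| < e.
  apply: le_lt_trans (hn0 m n0m).
  apply: le_trans (mu_series_abs d1 hP Y_harm Y_orth Y_span m n).
  apply: ler_sum => l _; rewrite /term2 normrM.
  have w0 : 0 <= mu_eig P l * (Ndim d l)%:R by rewrite mulr_ge0 // mu_eig_ge0.
  rewrite (ger0_norm w0) ler_piMr //.
  exact: (legendreP_le1 d1 hP Y_harm Y_orth Y_span).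
by split => //; under eq_bigr do rewrite term12 //.
Qed.
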